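(* There exist a poset $P$ and a coherent theory $\mathbb{T}$ such that the topos of co-presheaves $[P,\mathbf{Set}]$ (the category of functors $P \to \mathbf{Set}$, where $P$ is viewed as a category with a unique arrow $x \to y$ whenever $x \leqslant y$) does not realise types for $\mathbb{T}$.
   Context: A coherent theory is a (possibly many-sorted) first-order theory axiomatised by sequents $\varphi \vdash_{\vec{x}} \psi$ between coherent formulae, i.e. formulae built from atomic formulae (including equality) using $\top$, $\bot$, finite $\wedge$, finite $\vee$ and $\exists$. Let $\mathcal{P}$ be the classifying pretopos of $\mathbb{T}$ (the pretopos completion of the syntactic category of $\mathbb{T}$), so that, for every Grothendieck topos $\mathcal{E}$, models of $\mathbb{T}$ internal to $\mathcal{E}$ correspond to coherent functors $\mathcal{P} \to \mathcal{E}$. Let $\mathcal{D}$ be the distributive lattice of subterminal objects of $\mathcal{P}$ (equivalently, the lattice of coherent sentences of $\mathbb{T}$ up to $\mathbb{T}$-provable equivalence), regarded as a category, with inclusion $\mathcal{D} \hookrightarrow \mathcal{P}$. A coherent functor is one preserving finite limits, images (regular epimorphisms) and finite unions of subobjects; a coherent functor $\mathcal{D} \to \mathcal{E}$ amounts to a homomorphism of distributive lattices from $\mathcal{D}$ to the lattice of subterminal objects of $\mathcal{E}$. A Grothendieck topos $\mathcal{E}$ realises types for $\mathbb{T}$ (equivalently, for $\mathcal{P}$) if for every coherent functor $Q \colon \mathcal{D} \to \mathcal{E}$ there exist a coherent functor $M \colon \mathcal{P} \to \mathcal{E}$ and a natural transformation $Q \Rightarrow M|_{\mathcal{D}}$,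 where $M|_{\mathcal{D}}$ is the composite $\mathcal{D} \hookrightarrow \mathcal{P} \xrightarrow{M} \mathcal{E}$. *)

(* Defs.v *)
From mathcomp Require Import all_boot all_order.
From mathcomp Require Import boolp.

Set Implicit Arguments.
Unset Strict Implicit.
Unset Printing Implicit Defensive.

(** The sets of [set_category], of posets and of signatures all live in this
    universe, so that a poset [P] is small relative to [[P, Set]]. *)
Definition small_set := Type.

(** * Categories *)

Record category := Category {
  ob :> Type;
  mor : ob -> ob -> Type;
  idm : forall x, mor x x;
  compose : forall x y z, mor y z -> mor x y -> mor x z;
  compose_id_l : forall x y (f : mor x y), compose (idm y) f = f;
  compose_id_r : forall x y (f : mor x y), compose f (idm x) = f;
  compose_assoc : forall x y z w (h : mor z w) (g : mor y z) (f : mor x y),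
    compose h (compose g f) = compose (compose h g) f }.

Arguments mor {c} _ _.
Arguments idm {c} _.

Notation "g ∘ f" := (compose g f) (at level 40, left associativity).

Record functor (C D : category) := Functor {
  fob :> C -> D;
  fmor : forall x y, mor x y -> mor (fob x) (fob y);
  fmor_id : forall x, fmor (idm x) = idm (fob x);
  fmor_comp : forall x y z (g : mor y z) (f : mor x y),
    fmor (g ∘ f) = fmor g ∘ fmor f }.

Arguments fmor {C D} F {x y} _ : rename.

Record nattrans (C D : category) (F G : functor C D) := NatTrans {
  component :> forall x, mor (F x) (G x);
  naturality : forall x y (f : mor x y),
    component y ∘ fmor F f = fmor G f ∘ component x }.

Section FunctorComposition.
Variables (C D E : category) (G : functor D E) (F : functor C D).

Lemma functor_comp_id (x : C) : fmor G (fmor F (idm x)) = idm (G (F x)).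
Proof. by rewrite !fmor_id. Qed.

Lemma functor_comp_comp (x y z : C) (g : mor y z) (f : mor x y) :
  fmor G (fmor F (g ∘ f)) = fmor G (fmor F g) ∘ fmor G (fmor F f).
Proof. by rewrite !fmor_comp. Qed.

Definition functor_comp : functor C E :=
  @Functor C E (fun x => G (F x)) (fun x y f => fmor G (fmor F f))
    functor_comp_id functor_comp_comp.

End FunctorComposition.

Section FunctorCategory.
Variables C D : category.

Lemma nattrans_eq (F G : functor C D) (a b : nattrans F G) :
  (forall x, a x = b x) -> a = b.
Proof.
case: a b => [a na] [b nb] /= ab.
have {}ab : a = b by apply: functional_extensionality_dep.
by case: _ / ab in nb *; congr NatTrans; apply: Prop_irrelevance.
Qed.

Lemma nattrans_id_natural (F : functor C D) (x y : C) (f : mor x y) :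
  idm (F y) ∘ fmor F f = fmor F f ∘ idm (F x).
Proof. by rewrite compose_id_l compose_id_r. Qed.

Definition nattrans_id (F : functor C D) : nattrans F F :=
  NatTrans (@nattrans_id_natural F).

Lemma nattrans_comp_natural (F G H : functor C D)
    (b : nattrans G H) (a : nattrans F G) (x y : C) (f : mor x y) :
  (b y ∘ a y) ∘ fmor F f = fmor H f ∘ (b x ∘ a x).
Proof.
by rewrite -compose_assoc naturality compose_assoc naturality -compose_assoc.
Qed.

Definition nattrans_comp (F G H : functor C D)
    (b : nattrans G H) (a : nattrans F G) : nattrans F H :=
  NatTrans (@nattrans_comp_natural F G H b a).

Lemma nattrans_comp_id_l (F G : functor C D) (a : nattrans F G) :
  nattrans_comp (nattrans_id G) a = a.
Proof. by apply: nattrans_eq => x /=; rewrite compose_id_l. Qed.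

Lemma nattrans_comp_id_r (F G : functor C D) (a : nattrans F G) :
  nattrans_comp a (nattrans_id F) = a.
Proof. by apply: nattrans_eq => x /=; rewrite compose_id_r. Qed.

Lemma nattrans_comp_assoc (F G H K : functor C D)
    (c : nattrans H K) (b : nattrans G H) (a : nattrans F G) :
  nattrans_comp c (nattrans_comp b a) = nattrans_comp (nattrans_comp c b) a.
Proof. by apply: nattrans_eq => x /=; rewrite compose_assoc. Qed.

Definition functor_category : category :=
  @Category (functor C D) (@nattrans C D) nattrans_id nattrans_comp
    nattrans_comp_id_l nattrans_comp_id_r nattrans_comp_assoc.

End FunctorCategory.

Section FullSubcategory.
Variables (C : category) (S : C -> Prop).

Definition full_subcategory : category :=
  @Category {x : C | S x} (fun x y => mor (sval x) (sval y))
    (fun x => idm (sval x)) (fun x y z g f => g ∘ f)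
    (fun x y f => compose_id_l f) (fun x y f => compose_id_r f)
    (fun x y z w h g f => compose_assoc h g f).

Definition full_inclusion : functor full_subcategory C :=
  @Functor full_subcategory C (fun x => sval x) (fun x y f => f)
    (fun x => erefl) (fun x y z g f => erefl).

End FullSubcategory.

Definition set_category : category :=
  @Category small_set (fun A B => A -> B) (fun A x => x)
    (fun A B C g f x => g (f x))
    (fun A B f => erefl) (fun A B f => erefl) (fun A B C D h g f => erefl).

Definition poset_category (disp : Order.disp_t) (P : porderType disp) :
    category :=
  @Category (P : small_set) (fun x y => (x <= y)%O) (fun x => Order.POrderTheory.lexx x)
    (fun x y z yz xy => Order.POrderTheory.le_trans xy yz)
    (fun x y f => bool_irrelevance _ _) (fun x y f => bool_irrelevance _ _)
    (fun x y z w h g f => bool_irrelevance _ _).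

(** The topos [[P, Set]]. *)
Definition copresheaf_topos (disp : Order.disp_t) (P : porderType disp) :
    category :=
  functor_category (poset_category P) set_category.

(** * Coherent functors *)

Section Limits.
Variable C : category.

Definition is_terminal (t : C) : Prop := forall x, exists! f : mor x t, True.

Definition is_pullback (x y z w : C) (f : mor x z) (g : mor y z)
    (p : mor w x) (q : mor w y) : Prop :=
  f ∘ p = g ∘ q /\
  forall v (a : mor v x) (b : mor v y), f ∘ a = g ∘ b ->
    exists! h : mor v w, p ∘ h = a /\ q ∘ h = b.

Definition is_mono (x y : C) (m : mor x y) : Prop :=
  forall w (f g : mor w x), m ∘ f = m ∘ g -> f = g.

(** For monomorphisms this is the order on the subobjects of [y]. *)
Definition factors_through (x x' y : C) (f : mor x y) (m : mor x' y) : Prop :=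
  exists h : mor x x', f = m ∘ h.

Definition is_image (x i y : C) (f : mor x y) (m : mor i y) : Prop :=
  [/\ is_mono m, factors_through f m &
      forall j (m' : mor j y), is_mono m' -> factors_through f m' ->
        factors_through m m'].

Definition is_least_subobject (b y : C) (m : mor b y) : Prop :=
  is_mono m /\
  forall j (m' : mor j y), is_mono m' -> factors_through m m'.

Definition is_union (x1 x2 u y : C) (m1 : mor x1 y) (m2 : mor x2 y)
    (m : mor u y) : Prop :=
  [/\ is_mono m, factors_through m1 m, factors_through m2 m &
      forall j (m' : mor j y), is_mono m' ->
        factors_through m1 m' -> factors_through m2 m' ->
        factors_through m m'].

(** [x] is subterminal: the morphism from [x] to the terminal object is
    monic. *)
Definition is_subterminal (x : C) : Prop :=
  forall w (f g : mor w x), f = g.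

End Limits.

(** Finite limits are taken as the terminal object and pullbacks; finite
    unions as the empty union (the least subobject) and binary unions. *)
Record coherent_functor (C D : category) (F : functor C D) : Prop := {
  coherent_terminal : forall t : C, is_terminal t -> is_terminal (F t);
  coherent_pullback : forall (x y z w : C) (f : mor x z) (g : mor y z)
      (p : mor w x) (q : mor w y),
    is_pullback f g p q ->
    is_pullback (fmor F f) (fmor F g) (fmor F p) (fmor F q);
  coherent_image : forall (x i y : C) (f : mor x y) (m : mor i y),
    is_image f m -> is_image (fmor F f) (fmor F m);
  coherent_least : forall (b y : C) (m : mor b y),
    is_least_subobject m -> is_least_subobject (fmor F m);
  coherent_union : forall (x1 x2 u y : C) (m1 : mor x1 y) (m2 : mor x2 y)
      (m : mor u y),
    is_mono m1 -> is_mono m2 -> is_union m1 m2 m ->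
    is_union (fmor F m1) (fmor F m2) (fmor F m) }.

Definition subterminals (C : category) : category :=
  full_subcategory (@is_subterminal C).

Definition subterminals_inclusion (C : category) :
    functor (subterminals C) C :=
  full_inclusion (@is_subterminal C).

(** * Coherent theories *)

Record signature := Signature {
  sort : small_set;
  func : small_set;
  func_dom : func -> seq sort;
  func_cod : func -> sort;
  rel_sym : small_set;
  rel_dom : rel_sym -> seq sort }.

Section Syntax.
Variable S : signature.

(** A context is the list of the sorts of its variables; a variable of sort
    [A] is a position of [A] in the context (de Bruijn index). *)
Definition ctx := seq (sort S).

Inductive var : ctx -> sort S -> Type :=
| vz (G : ctx) A : var (A :: G) A
| vs (G : ctx) A B : var G A -> var (B :: G) A.

Inductive term (G : ctx) : sort S -> Type :=
| tvar A : var G A -> term G A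
| tapp f : (forall A, var (func_dom f) A -> term G A) -> term G (func_cod f).

(** Tuples of terms over [D], one for each variable of [G], of the same
    sort. *)
Definition subst (G D : ctx) := forall A, var G A -> term D A.

Inductive formula : ctx -> Type :=
| Rel G R : subst (rel_dom R) G -> formula G
| Eq G A : term G A -> term G A -> formula G
| Top G : formula G
| And G : formula G -> formula G -> formula G
| Bot G : formula G
| Or G : formula G -> formula G -> formula G
| Ex G A : formula (A :: G) -> formula G.

Fixpoint tsub G D (s : subst G D) A (t : term G A) : term D A :=
  match t with
  | tvar A v => s A v
  | tapp f ts => tapp (fun B v => tsub s (ts B v))
  end.

Definition sid G : subst G G := fun A v => tvar v.
Arguments sid : clear implicits.

Definition scomp G D E (s : subst G D) (r : subst D E) : subst G E :=
  fun A v => tsub r (s A v).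

Definition scons G D B (t : term D B) (s : subst G D) : subst (B :: G) D :=
  fun A v =>
    match v in var (B' :: G') A'
      return term D B' -> subst G' D -> term D A'
    with
    | vz _ _ => fun t _ => t
    | vs _ _ _ v' => fun _ s => s _ v'
    end t s.

Definition shift B G : subst G (B :: G) := fun A v => tvar (vs B v).
Arguments shift : clear implicits.

Definition up B G D (s : subst G D) : subst (B :: G) (B :: D) :=
  scons (tvar (vz D B)) (scomp s (shift B D)).
Arguments up B {G D} s.

Fixpoint fsub G D (s : subst G D) (phi : formula G) : formula D :=
  match phi in formula G return subst G D -> formula D with
  | Rel _ R ts => fun s => Rel (scomp ts s)
  | Eq _ _ t u => fun s => Eq (tsub s t) (tsub s u)
  | Top _ => fun s => Top D
  | And _ p q => fun s => And (fsub s p) (fsub s q)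
  | Bot _ => fun s => Bot D
  | Or _ p q => fun s => Or (fsub s p) (fsub s q)
  | Ex _ _ p => fun s => Ex (fsub (up _ s) p)
  end s.


Lemma var_caseP G B (P : forall A, var (B :: G) A -> Type) :
  P B (vz G B) -> (forall A (v : var G A), P A (vs B v)) ->
  forall A (v : var (B :: G) A), P A v.
Proof.
move=> Pz Ps A v.
move: P Pz Ps.
refine (match v as v' in var (B' :: G') A' return
  forall P : (forall A, var (B' :: G') A -> Type), P B' (vz G' B') ->
    (forall A (v : var G' A), P A (vs B' v)) -> P A' v' with
  | vz _ _ => fun P Pz Ps => Pz
  | vs _ _ _ w => fun P Pz Ps => Ps _ w end).
Qed.

Lemma subst_eq G D (s r : subst G D) :
  (forall A (v : var G A), s A v = r A v) -> s = r.
Proof.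
move=> sr; apply: functional_extensionality_dep => A.
by apply: functional_extensionality_dep => v.
Qed.

Lemma tsub_comp G D E (s : subst G D) (r : subst D E) A (t : term G A) :
  tsub r (tsub s t) = tsub (scomp s r) t.
Proof.
elim: t => //= f ts IH; congr tapp.
by apply: subst_eq => B v; apply: IH.
Qed.

Lemma tsub_id G A (t : term G A) : tsub (sid G) t = t.
Proof.
elim: t => //= f ts IH; congr tapp.
by apply: subst_eq => B v; apply: IH.
Qed.

Lemma scompA G D E F (s : subst G D) (r : subst D E) (q : subst E F) :
  scomp (scomp s r) q = scomp s (scomp r q).
Proof. by apply: subst_eq => A v; rewrite /scomp tsub_comp. Qed.

Lemma scomp_idr G D (s : subst G D) : scomp s (sid D) = s.
Proof. by apply: subst_eq => A v; rewrite /scomp tsub_id. Qed.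

Lemma scomp_idl G D (s : subst G D) : scomp (sid G) s = s.
Proof. by []. Qed.

Lemma scons_comp G D E B (t : term D B) (s : subst G D) (r : subst D E) :
  scomp (scons t s) r = scons (tsub r t) (scomp s r).
Proof. by apply: subst_eq; apply: var_caseP. Qed.

Lemma shift_scons G D B (t : term D B) (s : subst G D) :
  scomp (shift B G) (scons t s) = s.
Proof. by []. Qed.

Lemma scons_eta G D B (s : subst (B :: G) D) :
  scons (s B (vz G B)) (scomp (shift B G) s) = s.
Proof. by apply: subst_eq; apply: var_caseP. Qed.

Lemma up_id B G : up B (sid G) = sid (B :: G).
Proof. by apply: subst_eq; apply: var_caseP. Qed.

Lemma up_scons B G D E (s : subst G D) (t : term E B) (r : subst D E) :
  scomp (up B s) (scons t r) = scons t (scomp s r).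
Proof. by rewrite /up scons_comp /= scompA shift_scons. Qed.

Lemma up_comp B G D E (s : subst G D) (r : subst D E) :
  scomp (up B s) (up B r) = up B (scomp s r).
Proof. by rewrite {2}/up up_scons /up scompA. Qed.

Lemma fsub_comp G D E (s : subst G D) (r : subst D E) (phi : formula G) :
  fsub r (fsub s phi) = fsub (scomp s r) phi.
Proof.
elim: phi D E s r => //=.
- by move=> H R ts D E s r; rewrite scompA.
- by move=> H A t u D E s r; rewrite !tsub_comp.
- by move=> H p IHp q IHq D E s r; rewrite IHp IHq.
- by move=> H p IHp q IHq D E s r; rewrite IHp IHq.
- by move=> H A p IHp D E s r; rewrite IHp up_comp.
Qed.

Lemma fsub_id G (phi : formula G) : fsub (sid G) phi = phi.
Proof.
elim: phi => //=.
- by move=> H R ts; rewrite scomp_idr.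
- by move=> H A t u; rewrite !tsub_id.
- by move=> H p -> q ->.
- by move=> H p -> q ->.
- by move=> H A p IHp; rewrite up_id IHp.
Qed.

(** Concatenation of contexts; [G ++ D] is the context of a relation between
    tuples of type [G] and tuples of type [D]. *)
Fixpoint var_l G D A (v : var G A) : var (G ++ D) A :=
  match v in var G' A' return var (G' ++ D) A' with
  | vz _ _ => vz _ _
  | vs _ _ _ w => vs _ (var_l D w)
  end.

Fixpoint var_r G D A (v : var D A) : var (G ++ D) A :=
  match G return var (G ++ D) A with
  | [::] => v
  | _ :: G' => vs _ (var_r G' v)
  end.

Definition proj_l G D : subst G (G ++ D) := fun A v => tvar (var_l D v).
Definition proj_r G D : subst D (G ++ D) := fun A v => tvar (var_r G v).
Arguments proj_l : clear implicits.
Arguments proj_r : clear implicits.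

Fixpoint spair G D E : subst G E -> subst D E -> subst (G ++ D) E :=
  match G return subst G E -> subst D E -> subst (G ++ D) E with
  | [::] => fun _ r => r
  | B :: G' => fun s r => scons (s B (vz G' B)) (spair (scomp (shift B G') s) r)
  end.

Fixpoint exs Th G : formula (Th ++ G) -> formula G :=
  match Th return formula (Th ++ G) -> formula G with
  | [::] => fun phi => phi
  | A :: Th' => fun phi => exs (Ex phi)
  end.

Lemma spair_comp G D E F (s : subst G E) (r : subst D E) (q : subst E F) :
  scomp (spair s r) q = spair (scomp s q) (scomp r q).
Proof.
elim: G s => //= B G IH s.
by rewrite scons_comp IH -scompA.
Qed.

Lemma proj_l_spair G D E (s : subst G E) (r : subst D E) :
  scomp (proj_l G D) (spair s r) = s.
Proof.
apply: subst_eq => A v; rewrite /scomp /=.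
by elim: v s => //= G' A' B v IH s.
Qed.

Lemma proj_r_spair G D E (s : subst G E) (r : subst D E) :
  scomp (proj_r G D) (spair s r) = r.
Proof.
apply: subst_eq => A v; rewrite /scomp /=.
by elim: G s => //= B G IH s.
Qed.

Lemma spair_eta G D E (s : subst (G ++ D) E) :
  spair (scomp (proj_l G D) s) (scomp (proj_r G D) s) = s.
Proof.
elim: G s => [|B G IH] s //=.
by rewrite -[RHS]scons_eta -[in RHS](IH (scomp (shift B _) s)).
Qed.

Lemma spair_proj G D : spair (proj_l G D) (proj_r G D) = sid (G ++ D).
Proof. by rewrite -[RHS]spair_eta !scomp_idr. Qed.

Lemma fsub_exs Th G D (s : subst G D) (phi : formula (Th ++ G)) :
  fsub s (exs phi) =
  exs (fsub (spair (proj_l Th D) (scomp s (proj_r Th D))) phi).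
Proof.
elim: Th G D s phi => [|A Th IH] G D s phi /=.
  by congr fsub; rewrite -[LHS]scomp_idr.
rewrite IH /=; congr (exs (Ex (fsub _ _))).
rewrite /up spair_comp scompA.
by congr scons.
Qed.

End Syntax.

Arguments sid {S} G.
Arguments shift {S} B G.
Arguments up {S} B {G D} s.
Arguments proj_l {S} G D.
Arguments proj_r {S} G D.

(** The axioms are the sequents [phi |-_G psi] satisfying [axioms]. *)
Record coherent_theory := CoherentTheory {
  sig :> signature;
  axioms : forall G : ctx sig, formula G -> formula G -> Prop }.

(** [prov T phi psi]: the sequent [phi |-_G psi] is derivable from [T] in the
    sequent calculus of coherent logic.  Contexts are part of the sequents, so
    sorts may be empty. *)
Inductive prov (T : coherent_theory) :
    forall G : ctx T, formula G -> formula G -> Prop :=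
| prov_axiom G (p q : formula G) : axioms p q -> prov p q
| prov_id G (p : formula G) : prov p p
| prov_cut G (p q r : formula G) : prov p q -> prov q r -> prov p r
| prov_subst G D (s : subst G D) (p q : formula G) :
    prov p q -> prov (fsub s p) (fsub s q)
| prov_eq_refl G A (t : term G A) : prov (Top G) (Eq t t)
| prov_eq_subst G A (t u : term G A) (p : formula (A :: G)) :
    prov (And (Eq t u) (fsub (scons t (sid G)) p)) (fsub (scons u (sid G)) p)
| prov_top G (p : formula G) : prov p (Top G)
| prov_and_l G (p q : formula G) : prov (And p q) p
| prov_and_r G (p q : formula G) : prov (And p q) q
| prov_and G (p q r : formula G) : prov p q -> prov p r -> prov p (And q r)
| prov_bot G (p : formula G) : prov (Bot G) p
| prov_or_l G (p q : formula G) : prov p (Or p q)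
| prov_or_r G (p q : formula G) : prov q (Or p q)
| prov_or G (p q r : formula G) : prov p r -> prov q r -> prov (Or p q) r
| prov_ex G A (p : formula (A :: G)) (q : formula G) :
    prov p (fsub (shift A G) q) -> prov (Ex p) q
| prov_ex_inv G A (p : formula (A :: G)) (q : formula G) :
    prov (Ex p) q -> prov p (fsub (shift A G) q)
| prov_distr G (p q r : formula G) :
    prov (And p (Or q r)) (Or (And p q) (And p r))
| prov_frobenius G A (p : formula G) (q : formula (A :: G)) :
    prov (And p (Ex q)) (Ex (And (fsub (shift A G) p) q)).

Section Derived.
Variable T : coherent_theory.
Implicit Types G D E : ctx T.

Local Notation "p |-- q" := (prov p q) (at level 70).

Lemma prov_ex_intro G A (t : term G A) (p : formula (A :: G)) :
  fsub (scons t (sid G)) p |-- Ex p.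
Proof.
have := prov_subst (scons t (sid G)) (prov_ex_inv (prov_id (Ex p))).
by rewrite fsub_comp shift_scons fsub_id.
Qed.

Lemma prov_exs_intro Th G (u : subst Th G) (p : formula (Th ++ G)) :
  fsub (spair u (sid G)) p |-- exs p.
Proof.
elim: Th u p => [|A Th IH] u p /=; first by rewrite fsub_id; apply: prov_id.
apply: prov_cut (IH (scomp (shift A Th) u) (Ex p)) => /=.
have := prov_ex_intro (u A (vz Th A))
  (fsub (up A (spair (scomp (shift A Th) u) (sid G))) p).
by rewrite fsub_comp up_scons scomp_idr.
Qed.

Lemma prov_exs Th G (p : formula (Th ++ G)) (q : formula G) :
  p |-- fsub (proj_r Th G) q -> exs p |-- q.
Proof.
elim: Th p => [|A Th IH] p /=; first by rewrite fsub_id.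
move=> pq; apply: IH; apply: prov_ex.
by rewrite fsub_comp.
Qed.

Lemma prov_exs_mono Th G (p q : formula (Th ++ G)) :
  p |-- q -> exs p |-- exs q.
Proof.
elim: Th p q => [|A Th IH] p q //= pq; apply: IH; apply: prov_ex.
apply: prov_cut pq _; apply: prov_ex_inv; exact: prov_id.
Qed.

Lemma prov_exs_frobenius Th G (p : formula G) (q : formula (Th ++ G)) :
  And p (exs q) |-- exs (And (fsub (proj_r Th G) p) q).
Proof.
elim: Th q => [|A Th IH] q /=; first by rewrite fsub_id; apply: prov_id.
apply: prov_cut (IH (Ex q)) _; apply: prov_exs_mono.
apply: prov_cut (prov_frobenius _ _) _.
rewrite fsub_comp; exact: prov_id.
Qed.

(** To use [exs p] at a tuple [s], pass to a context with fresh variables. *)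
Lemma prov_exs_elim Th G D (s : subst G D) (p : formula (Th ++ G))
    (h q : formula D) :
  And (fsub (proj_r Th D) h)
      (fsub (spair (proj_l Th D) (scomp s (proj_r Th D))) p)
    |-- fsub (proj_r Th D) q ->
  And h (fsub s (exs p)) |-- q.
Proof.
move=> hpq; rewrite fsub_exs.
exact: prov_cut (prov_exs_frobenius _ _) (prov_exs hpq).
Qed.

Lemma prov_exs_intro_sub Th G D (s : subst G D) (u : subst Th D)
    (p : formula (Th ++ G)) :
  fsub (spair u s) p |-- fsub s (exs p).
Proof.
rewrite fsub_exs; have := prov_exs_intro u
  (fsub (spair (proj_l Th D) (scomp s (proj_r Th D))) p).
by rewrite fsub_comp spair_comp proj_l_spair scompA proj_r_spair scomp_idr.
Qed.

Lemma prov_and_mono G (p q p' q' : formula G) :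
  p |-- p' -> q |-- q' -> And p q |-- And p' q'.
Proof.
move=> pp qq; apply: prov_and.
  exact: prov_cut (prov_and_l _ _) pp.
exact: prov_cut (prov_and_r _ _) qq.
Qed.

Definition bigor G n (F : 'I_n -> formula G) : formula G :=
  \big[@Or T G/Bot G]_(k < n) F k.

Lemma prov_bigor_intro G n (F : 'I_n -> formula G) k : F k |-- bigor F.
Proof.
rewrite /bigor unlock /reducebig.
have: k \in index_enum 'I_n by rewrite mem_index_enum.
elim: (index_enum _) => //= a r IH; rewrite inE => /predU1P[<-|kr].
  exact: prov_or_l.
exact: prov_cut (IH kr) (prov_or_r _ _).
Qed.

Lemma fsub_bigor G D (s : subst G D) n (F : 'I_n -> formula G) :
  fsub s (bigor F) = bigor (fun k => fsub s (F k)).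
Proof. by rewrite /bigor (big_morph (fsub s) (id1 := Bot D) (op1 := @Or T D)). Qed.

Lemma prov_bigor_elim G n (F : 'I_n -> formula G) (h q : formula G) :
  (forall k, And h (F k) |-- q) -> And h (bigor F) |-- q.
Proof.
move=> H; rewrite /bigor; elim/big_rec: _ => [|k p _ IH].
  exact: prov_cut (prov_and_r _ _) (prov_bot _).
exact: prov_cut (prov_distr _ _ _) (prov_or (H k) IH).
Qed.

Lemma prov_cut_and G (h p q : formula G) :
  h |-- p -> And h p |-- q -> h |-- q.
Proof. by move=> hp; apply: prov_cut; apply: prov_and => //; apply: prov_id. Qed.

End Derived.

(** * The classifying pretopos *)

Section ClassifyingPretopos.
Variable T : coherent_theory.
Implicit Types D E : ctx T.

Local Notation "p |-- q" := (prov p q) (at level 70).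

(** [inst p s t] is [p(s, t)], for [p(x, y)] a relation between two tuples of
    variables. *)
Local Notation inst p s t := (fsub (spair s t) p).

(** The pretopos completion of the syntactic category, in one step: an object
    is the quotient of the formal coproduct of finitely many formulae in
    context [{x_i. dom i}] by a provable equivalence relation, whose
    restriction to the components [i] and [j] is [{x_i, x_j. eqv i j}].  The
    conditions are stated for all tuples of terms in all contexts, which by
    [prov_subst] is the same as stating them for tuples of variables. *)
Record pretopos_ob := PretoposOb {
  arity : nat;
  octx : 'I_arity -> ctx T;
  odom : forall i, formula (octx i);
  oeqv : forall i j, formula (octx i ++ octx j);
  oeqv_dom : forall i j D (s : subst (octx i) D) (t : subst (octx j) D),
    inst (oeqv i j) s t |-- And (fsub s (odom i)) (fsub t (odom j));
  oeqv_refl : forall i D (s : subst (octx i) D),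
    fsub s (odom i) |-- inst (oeqv i i) s s;
  oeqv_sym : forall i j D (s : subst (octx i) D) (t : subst (octx j) D),
    inst (oeqv i j) s t |-- inst (oeqv j i) t s;
  oeqv_trans : forall i j k D (s : subst (octx i) D) (t : subst (octx j) D)
      (u : subst (octx k) D),
    And (inst (oeqv i j) s t) (inst (oeqv j k) t u) |-- inst (oeqv i k) s u }.

(** Morphisms are the relations between the coproducts that are provably
    compatible with the equivalence relations, single-valued and total, up to
    provable equivalence. *)
Definition matrix (X Y : pretopos_ob) :=
  forall (i : 'I_(arity X)) (k : 'I_(arity Y)), formula (octx i ++ octx k).

Record functional (X Y : pretopos_ob) (g : matrix X Y) : Prop := {
  functional_dom : forall i k D (s : subst (octx i) D) (t : subst (octx k) D),
    inst (g i k) s t |-- And (fsub s (odom i)) (fsub t (odom k));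
  functional_eqv : forall i i' k k' D
      (s : subst (octx i) D) (s' : subst (octx i') D)
      (t : subst (octx k) D) (t' : subst (octx k') D),
    And (inst (g i k) s t)
        (And (inst (oeqv i i') s s') (inst (oeqv k k') t t'))
      |-- inst (g i' k') s' t';
  functional_single : forall i k k' D (s : subst (octx i) D)
      (t : subst (octx k) D) (t' : subst (octx k') D),
    And (inst (g i k) s t) (inst (g i k') s t') |-- inst (oeqv k k') t t';
  functional_total : forall i,
    odom i |-- bigor (fun k =>
      exs (inst (g i k) (proj_r (octx k) (octx i))
                        (proj_l (octx k) (octx i)))) }.

Definition matrix_equiv (X Y : pretopos_ob) (g h : matrix X Y) : Prop :=
  forall i k, g i k |-- h i k /\ h i k |-- g i k.

Definition pretopos_mor (X Y : pretopos_ob) : Type :=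
  {c : matrix X Y -> Prop | exists2 g, functional g & c = matrix_equiv g}.

(** Relational composition:
    [(h o g)(x, z)] is the disjunction over [k] of
    [exists y_k, g i k (x, y_k) /\ h k l (y_k, z)]. *)
Definition matrix_comp (X Y Z : pretopos_ob) (h : matrix Y Z)
    (g : matrix X Y) : matrix X Z := fun i l =>
  bigor (fun k =>
    let y := proj_l (octx k) (octx i ++ octx l) in
    let w := proj_r (octx k) (octx i ++ octx l) in
    let x := scomp (proj_l (octx i) (octx l)) w in
    let z := scomp (proj_r (octx i) (octx l)) w in
    exs (And (inst (g i k) x y) (inst (h k l) y z))).

Lemma inst_sub G G' D E (p : formula (G ++ G')) (s : subst G D)
    (t : subst G' D) (r : subst D E) :
  fsub r (inst p s t) = inst p (scomp s r) (scomp t r).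
Proof. by rewrite fsub_comp spair_comp. Qed.

Lemma matrix_comp_intro X Y Z (h : matrix Y Z) (g : matrix X Y) i k l D
    (s : subst (octx i) D) (u : subst (octx k) D) (t : subst (octx l) D)
    (H : formula D) :
  H |-- inst (g i k) s u -> H |-- inst (h k l) u t ->
  H |-- inst (matrix_comp h g i l) s t.
Proof.
move=> Hg Hh; rewrite /matrix_comp fsub_bigor.
apply: prov_cut (prov_bigor_intro _ k) => /=.
apply: prov_cut (prov_exs_intro_sub _ u _).
rewrite /= !inst_sub !scompA !proj_l_spair !proj_r_spair.
by rewrite !proj_l_spair; apply: prov_and.
Qed.

Lemma matrix_comp_elim X Y Z (h : matrix Y Z) (g : matrix X Y) i l D
    (s : subst (octx i) D) (t : subst (octx l) D) (H q : formula D) :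
  (forall k E (w : subst D E) (u : subst (octx k) E),
    And (fsub w H) (And (inst (g i k) (scomp s w) u)
                        (inst (h k l) u (scomp t w))) |-- fsub w q) ->
  And H (inst (matrix_comp h g i l) s t) |-- q.
Proof.
move=> Hq; rewrite /matrix_comp fsub_bigor; apply: prov_bigor_elim => k.
apply: prov_exs_elim => /=.
rewrite !inst_sub !scompA !proj_l_spair !proj_r_spair.
rewrite -(scompA (proj_l (octx i) _)) -(scompA (proj_r (octx i) _)).
by rewrite !proj_l_spair !proj_r_spair; apply: Hq.
Qed.

Ltac conjunct :=
  first [ exact: prov_id
        | apply: prov_cut (prov_and_l _ _) _; conjunct
        | apply: prov_cut (prov_and_r _ _) _; conjunct ].

Lemma functional_total_intro X Y (g : matrix X Y) i k D
    (s : subst (octx i) D) (u : subst (octx k) D) (H : formula D) :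
  H |-- inst (g i k) s u ->
  H |-- fsub s (bigor (fun k => exs (inst (g i k)
          (proj_r (octx k) (octx i)) (proj_l (octx k) (octx i))))).
Proof.
move=> Hg; rewrite fsub_bigor; apply: prov_cut (prov_bigor_intro _ k) => /=.
apply: prov_cut (prov_exs_intro_sub _ u _).
by rewrite inst_sub proj_l_spair proj_r_spair.
Qed.

Lemma functional_total_elim X Y (g : matrix X Y) i D (s : subst (octx i) D)
    (H q : formula D) :
  functional g -> H |-- fsub s (odom i) ->
  (forall k E (w : subst D E) (u : subst (octx k) E),
    And (fsub w H) (inst (g i k) (scomp s w) u) |-- fsub w q) ->
  H |-- q.
Proof.
move=> gF Hs Hq.
apply: prov_cut_and (prov_cut Hs (prov_subst s (functional_total gF i))) _.
rewrite fsub_bigor; apply: prov_bigor_elim => k.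
apply: prov_exs_elim.
rewrite inst_sub proj_l_spair proj_r_spair.
exact: Hq.
Qed.

Lemma matrix_equiv_inst X Y (g h : matrix X Y) :
  (forall i k D (s : subst (octx i) D) (t : subst (octx k) D),
    inst (g i k) s t |-- inst (h i k) s t /\
    inst (h i k) s t |-- inst (g i k) s t) ->
  matrix_equiv g h.
Proof.
move=> gh i k.
have := gh i k _ (proj_l (octx i) (octx k)) (proj_r (octx i) (octx k)).
by rewrite spair_proj !fsub_id.
Qed.

Lemma matrix_equivE X Y (g h : matrix X Y) :
  matrix_equiv g h -> matrix_equiv g = matrix_equiv h.
Proof.
move=> gh; apply/funext => m; apply/propext; split=> H i k.
- split; first exact: prov_cut (gh i k).2 (H i k).1.
  exact: prov_cut (H i k).2 (gh i k).1.
- split; first exact: prov_cut (gh i k).1 (H i k).1.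
  exact: prov_cut (H i k).2 (gh i k).2.
Qed.

Lemma functional_id X : functional (oeqv (p := X)).
Proof.
split.
- exact: oeqv_dom.
- move=> i i' k k' D s s' t t'.
  apply: prov_cut (oeqv_trans s' t t'); apply: prov_and; last by conjunct.
  apply: prov_cut (oeqv_trans s' s t); apply: prov_and; last by conjunct.
  by apply: prov_cut (oeqv_sym s s'); conjunct.
- move=> i k k' D s t t'.
  apply: prov_cut (oeqv_trans t s t'); apply: prov_and; last by conjunct.
  by apply: prov_cut (oeqv_sym s t); conjunct.
- move=> i; rewrite -[X in _ |-- X](fsub_id).
  apply: (@functional_total_intro X X (@oeqv X) i i _ (sid _) (sid _)).
  by rewrite -{1}[odom i]fsub_id; apply: oeqv_refl.
Qed.

Lemma functional_use_eqv X Y (g : matrix X Y) i i' k k' D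
    (s : subst (octx i) D) (s' : subst (octx i') D)
    (t : subst (octx k) D) (t' : subst (octx k') D) (H : formula D) :
  functional g -> H |-- inst (g i k) s t ->
  H |-- inst (oeqv i i') s s' -> H |-- inst (oeqv k k') t t' ->
  H |-- inst (g i' k') s' t'.
Proof.
move=> gF Hg Hs Ht; apply: prov_cut (functional_eqv gF s s' t t').
by apply: prov_and => //; apply: prov_and.
Qed.

Lemma functional_refl_l X Y (g : matrix X Y) i k D
    (s : subst (octx i) D) (t : subst (octx k) D) (H : formula D) :
  functional g -> H |-- inst (g i k) s t -> H |-- inst (oeqv i i) s s.
Proof.
move=> gF Hg; apply: prov_cut (oeqv_refl s).
exact: prov_cut (prov_cut Hg (functional_dom gF s t)) (prov_and_l _ _).
Qed.

Lemma functional_refl_r X Y (g : matrix X Y) i k D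
    (s : subst (octx i) D) (t : subst (octx k) D) (H : formula D) :
  functional g -> H |-- inst (g i k) s t -> H |-- inst (oeqv k k) t t.
Proof.
move=> gF Hg; apply: prov_cut (oeqv_refl t).
exact: prov_cut (prov_cut Hg (functional_dom gF s t)) (prov_and_r _ _).
Qed.

Lemma functional_use_single X Y (g : matrix X Y) i k k' D
    (s : subst (octx i) D) (t : subst (octx k) D) (t' : subst (octx k') D)
    (H : formula D) :
  functional g -> H |-- inst (g i k) s t -> H |-- inst (g i k') s t' ->
  H |-- inst (oeqv k k') t t'.
Proof.
move=> gF Hg Hg'; apply: prov_cut (functional_single gF s t t').
exact: prov_and.
Qed.

Lemma matrix_comp_use X Y Z (h : matrix Y Z) (g : matrix X Y) i l D
    (s : subst (octx i) D) (t : subst (octx l) D) (H q : formula D) :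
  H |-- inst (matrix_comp h g i l) s t ->
  (forall k E (w : subst D E) (u : subst (octx k) E),
    And (fsub w H) (And (inst (g i k) (scomp s w) u)
                        (inst (h k l) u (scomp t w))) |-- fsub w q) ->
  H |-- q.
Proof. by move=> Hc Hq; apply: prov_cut_and Hc (matrix_comp_elim Hq). Qed.

Lemma functional_comp X Y Z (h : matrix Y Z) (g : matrix X Y) :
  functional h -> functional g -> functional (matrix_comp h g).
Proof.
move=> hF gF; split.
- move=> i l D s t; apply: matrix_comp_use (prov_id _) _ => k E w u /=.
  rewrite !fsub_comp; apply: prov_and.
    apply: prov_cut (prov_and_l _ (fsub u (odom k))).
    by apply: prov_cut (functional_dom gF _ _); conjunct.
  apply: prov_cut (prov_and_r (fsub u (odom k)) _).
  by apply: prov_cut (functional_dom hF _ _); conjunct.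
- move=> i i' l l' D s s' t t'.
  apply: matrix_comp_use (prov_and_l _ _) _ => k E w u /=.
  rewrite !inst_sub; apply: (@matrix_comp_intro _ _ _ _ _ _ _ _ _ _ u).
    apply: (functional_use_eqv (i := i) (k := k) (s := scomp s w) (t := u) gF).
    + by conjunct.
    + by conjunct.
    + by apply: (functional_refl_r (s := scomp s w) gF); conjunct.
  apply: (functional_use_eqv (i := k) (k := l) (s := u) (t := scomp t w) hF).
  + by conjunct.
  + by apply: (functional_refl_r (s := scomp s w) gF); conjunct.
  + by conjunct.
- move=> i l l' D s t t'.
  apply: matrix_comp_use (prov_and_l _ _) _ => k E w u /=.
  rewrite !inst_sub.
  apply: (@matrix_comp_use _ _ _ h g i l' _ (scomp s w) (scomp t' w)).
    by conjunct.
  move=> k' F r u' /=; rewrite !inst_sub.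
  apply: (functional_use_single (s := u') hF); last by conjunct.
  apply: (functional_use_eqv (s := scomp u r) (t := scomp (scomp t w) r) hF).
  + by conjunct.
  + by apply: (functional_use_single (s := scomp (scomp s w) r) gF); conjunct.
  + by apply: (functional_refl_r (s := scomp u r) hF); conjunct.
- move=> i; rewrite -[X in _ |-- X]fsub_id.
  apply: (functional_total_elim gF (i := i) (s := sid _)).
    by rewrite fsub_id; apply: prov_id.
  move=> k E w u; rewrite fsub_comp scomp_idl.
  apply: (functional_total_elim hF (i := k) (s := u)).
    apply: prov_cut (prov_and_r (fsub w (odom i)) _).
    by apply: prov_cut (functional_dom gF w u); conjunct.
  move=> l F r v; rewrite fsub_comp; apply: (functional_total_intro (u := v)).
  apply: (@matrix_comp_intro _ _ _ _ _ _ _ _ _ _ (scomp u r)); last by conjunct.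
  by rewrite /= inst_sub; conjunct.
Qed.

Lemma matrix_comp_equiv X Y Z (h h' : matrix Y Z) (g g' : matrix X Y) :
  matrix_equiv h h' -> matrix_equiv g g' ->
  matrix_equiv (matrix_comp h g) (matrix_comp h' g').
Proof.
move=> hh gg; apply: matrix_equiv_inst => i l D s t; split.
- apply: matrix_comp_use (prov_id _) _ => k E w u; rewrite !inst_sub.
  apply: (@matrix_comp_intro _ _ _ _ _ _ _ _ _ _ u).
  + by apply: prov_cut (prov_subst _ (gg i k).1); conjunct.
  + by apply: prov_cut (prov_subst _ (hh k l).1); conjunct.
- apply: matrix_comp_use (prov_id _) _ => k E w u; rewrite !inst_sub.
  apply: (@matrix_comp_intro _ _ _ _ _ _ _ _ _ _ u).
  + by apply: prov_cut (prov_subst _ (gg i k).2); conjunct.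
  + by apply: prov_cut (prov_subst _ (hh k l).2); conjunct.
Qed.

Lemma matrix_comp_id_l X Y (g : matrix X Y) :
  functional g -> matrix_equiv (matrix_comp (@oeqv Y) g) g.
Proof.
move=> gF; apply: matrix_equiv_inst => i l D s t; split.
- apply: matrix_comp_use (prov_id _) _ => k E w u; rewrite !inst_sub.
  apply: (functional_use_eqv (s := scomp s w) (t := u) gF).
  + by conjunct.
  + by apply: (functional_refl_l (t := u) gF); conjunct.
  + by conjunct.
- apply: (@matrix_comp_intro _ _ _ _ _ _ _ _ _ _ t); first by conjunct.
  by apply: (functional_refl_r (s := s) gF); conjunct.
Qed.

Lemma matrix_comp_id_r X Y (g : matrix X Y) :
  functional g -> matrix_equiv (matrix_comp g (@oeqv X)) g.
Proof.
move=> gF; apply: matrix_equiv_inst => i l D s t; split.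
- apply: matrix_comp_use (prov_id _) _ => k E w u; rewrite !inst_sub.
  apply: (functional_use_eqv (s := u) (t := scomp t w) gF).
  + by conjunct.
  + by apply: prov_cut (oeqv_sym _ _); conjunct.
  + by apply: (functional_refl_r (s := u) gF); conjunct.
- apply: (@matrix_comp_intro _ _ _ _ _ _ _ _ _ _ s); last by conjunct.
  by apply: (functional_refl_l (t := t) gF); conjunct.
Qed.

Lemma matrix_comp_assoc X Y Z W (k : matrix Z W) (h : matrix Y Z)
    (g : matrix X Y) :
  matrix_equiv (matrix_comp k (matrix_comp h g))
               (matrix_comp (matrix_comp k h) g).
Proof.
apply: matrix_equiv_inst => i l D s t; split.
- apply: matrix_comp_use (prov_id _) _ => c E w u; rewrite !inst_sub.
  apply: (@matrix_comp_use _ _ _ h g i c _ (scomp s w) u); first by conjunct.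
  move=> b F r v /=; rewrite !inst_sub.
  apply: (@matrix_comp_intro _ _ _ _ _ _ _ _ _ _ v); first by conjunct.
  by apply: (@matrix_comp_intro _ _ _ _ _ _ _ _ _ _ (scomp u r)); conjunct.
- apply: matrix_comp_use (prov_id _) _ => b E w u; rewrite !inst_sub.
  apply: (@matrix_comp_use _ _ _ k h b l _ u (scomp t w)); first by conjunct.
  move=> c F r v /=; rewrite !inst_sub.
  apply: (@matrix_comp_intro _ _ _ _ _ _ _ _ _ _ v); last by conjunct.
  by apply: (@matrix_comp_intro _ _ _ _ _ _ _ _ _ _ (scomp u r)); conjunct.
Qed.

Definition pretopos_class X Y (g : matrix X Y) (gF : functional g) :
    pretopos_mor X Y :=
  exist _ (matrix_equiv g) (ex_intro2 _ _ g gF erefl).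

Lemma pretopos_class_surj X Y (c : pretopos_mor X Y) :
  exists g (gF : functional g), c = pretopos_class gF.
Proof.
case: c => c cP; have [g gF cg] := cP; exists g, gF.
by apply: eq_exist.
Qed.

Lemma pretopos_class_eq X Y (g h : matrix X Y) (gF : functional g)
    (hF : functional h) :
  pretopos_class gF = pretopos_class hF <-> matrix_equiv g h.
Proof.
split=> [/(congr1 sval) /= e|gh]; last first.
  by apply: eq_exist => /=; apply: matrix_equivE.
by rewrite e => i k; split; apply: prov_id.
Qed.

Definition pretopos_id X : pretopos_mor X X :=
  pretopos_class (functional_id X).

Lemma pretopos_comp_subproof X Y Z (d : pretopos_mor Y Z)
    (c : pretopos_mor X Y) :
  exists2 m, functional m &
    (fun n => exists h g, [/\ sval d h, sval c g &
       matrix_equiv (matrix_comp h g) n]) = matrix_equiv m.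
Proof.
have [h [hF ->]] := pretopos_class_surj d.
have [g [gF ->]] := pretopos_class_surj c.
exists (matrix_comp h g); first exact: functional_comp.
apply/funext => n; apply/propext; split => [[h' [g' [/= hh gg]]]|mn].
  by rewrite (matrix_equivE (matrix_comp_equiv hh gg)).
by exists h, g; split=> // i k; split; apply: prov_id.
Qed.

Definition pretopos_comp X Y Z (d : pretopos_mor Y Z) (c : pretopos_mor X Y) :
    pretopos_mor X Z :=
  exist _ _ (pretopos_comp_subproof d c).

Lemma pretopos_comp_class X Y Z (h : matrix Y Z) (g : matrix X Y)
    (hF : functional h) (gF : functional g) :
  pretopos_comp (pretopos_class hF) (pretopos_class gF) =
  pretopos_class (functional_comp hF gF).
Proof.
apply: eq_exist => /=; apply/funext => n; apply/propext.
split => [[h' [g' [/= hh gg]]]|mn].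
  by rewrite (matrix_equivE (matrix_comp_equiv hh gg)).
by exists h, g; split=> // i k; split; apply: prov_id.
Qed.

Lemma pretopos_comp_id_l X Y (c : pretopos_mor X Y) :
  pretopos_comp (pretopos_id Y) c = c.
Proof.
have [g [gF ->]] := pretopos_class_surj c; rewrite pretopos_comp_class.
by apply/pretopos_class_eq; apply: matrix_comp_id_l.
Qed.

Lemma pretopos_comp_id_r X Y (c : pretopos_mor X Y) :
  pretopos_comp c (pretopos_id X) = c.
Proof.
have [g [gF ->]] := pretopos_class_surj c; rewrite pretopos_comp_class.
by apply/pretopos_class_eq; apply: matrix_comp_id_r.
Qed.

Lemma pretopos_comp_assoc X Y Z W (e : pretopos_mor Z W)
    (d : pretopos_mor Y Z) (c : pretopos_mor X Y) :
  pretopos_comp e (pretopos_comp d c) = pretopos_comp (pretopos_comp e d) c.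
Proof.
have [k [kF ->]] := pretopos_class_surj e.
have [h [hF ->]] := pretopos_class_surj d.
have [g [gF ->]] := pretopos_class_surj c.
rewrite !pretopos_comp_class.
by apply/pretopos_class_eq; apply: matrix_comp_assoc.
Qed.

Definition classifying_pretopos : category :=
  @Category pretopos_ob pretopos_mor pretopos_id pretopos_comp
    pretopos_comp_id_l pretopos_comp_id_r pretopos_comp_assoc.

End ClassifyingPretopos.

(** * Realising types *)

(** [E] realises types for the pretopos [P]: every coherent functor on the
    subterminal objects of [P] maps to the restriction of one on [P].  The full
    subcategory of subterminal objects is equivalent to the lattice of
    subobjects of the terminal object. *)
Definition realises_types_pretopos (P E : category) : Prop :=
  forall Q : functor (subterminals P) E, coherent_functor Q ->
  exists2 M : functor P E, coherent_functor M &
    inhabited (nattrans Q (functor_comp M (subterminals_inclusion P))).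

Definition realises_types (T : coherent_theory) (E : category) : Prop :=
  realises_types_pretopos (classifying_pretopos T) E.

(* Main.v *)
Require Import Defs.
From HB Require Import structures.
From mathcomp Require Import all_boot all_order.
From mathcomp Require Import boolp.

(** A type in [[P, Set]] only records which coherent sentences hold at each
    stage of [P], so it grows along [p <= q] as soon as the structures realising
    it at [p] and [q] are connected by some homomorphism.  A model in [[P, Set]]
    needs homomorphisms that compose functorially.  The counterexample is a
    diagram of structures on a poset that commutes only up to a twist, for a
    theory which detects the twist without having a sentence that says so.

    The poset has a least element [origin], two incomparable elements [middle s]
    above it and two incomparable elements [upper e] above both [middle s], for
    [s] and [e] booleans.  The theory [twist] has one sort, provably inhabited,
    propositions [side s] and [sign e], and unary predicates [mark s v].  When
    [side s] holds, every individual has the mark [mark s true] or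
    [mark s false]; when [sign e] holds, the marks [mark true v] and
    [mark false w] exclude each other unless [(v == w) = e].

    At every stage there is a two-element structure satisfying the theory, with
    [side s] from [middle s] on and [sign e] exactly at [upper e]
    ([stage_model]).  Every inequality between stages is witnessed by a
    homomorphism ([twist_hom]), but the one from [middle false] to [upper e] is
    the identity or the negation according to [e].  The theories of these
    structures are therefore prime filters of sentences, increasing in the
    stage, and such a family is a coherent functor on the subterminal objects of
    the classifying pretopos ([type_functor_coherent]).

    Suppose that a coherent functor [M] realised this type.  An individual of
    [M] at [origin] acquires a mark [mark true v] at [middle true] and a mark
    [mark false w] at [middle false].  By functoriality it carries both at
    [upper true] and at [upper false], so [v == w] would have to be true and
    false.  Two general developments give a meaning to this argument.  The
    semantics of coherent logic in [[P, Set]], for formulae in one variable, is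
    read off from [M] by exhibiting comprehensions [{x : A. phi}] as pullbacks,
    images and unions in the classifying pretopos ([forces_and], [forces_or],
    [forces_bot], [forces_weaken], [individual_exists]).  Subterminal objects of
    the pretopos are compared with sentences by [mor_to_sent] and
    [mor_from_sent]. *)

Set Implicit Arguments.
Unset Strict Implicit.
Unset Printing Implicit Defensive.

Local Notation inst p s t := (fsub (spair s t) p).

#[local] Obligation Tactic := idtac.

(** * Copresheaves on a poset *)

Lemma sval_inj (U : Type) (S : U -> Prop) : injective (@sval U S).
Proof. by move=> [u Su] [v Sv] /= uv; apply: eq_exist. Qed.

Section Copresheaves.
Variables (disp : Order.disp_t) (P : porderType disp).
Local Notation E := (copresheaf_topos P).
Local Notation arrow p q := (mor (c := poset_category P) p q).
Implicit Types F G : E.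

Lemma component_eq F G (a b : mor F G) (p : P) :
  a = b -> component a p = component b p.
Proof. by move->. Qed.

Lemma restr_id F (p : P) (u : F p) (h : (p <= p)%O) :
  fmor F (h : arrow p p) u = u.
Proof.
have -> : h = idm (c := poset_category P) p by apply: bool_irrelevance.
by rewrite (fmor_id F).
Qed.

Lemma restr_comp F (p q r : P) (h : (p <= q)%O) (k : (q <= r)%O)
    (l : (p <= r)%O) (u : F p) :
  fmor F (k : arrow q r)
    (fmor F (h : arrow p q) u) =
  fmor F (l : arrow p r) u.
Proof.
have -> : l = compose (c := poset_category P) k h by apply: bool_irrelevance.
by rewrite (fmor_comp F).
Qed.

Lemma nat_app F G (a : nattrans F G) (p q : P)
    (h : arrow p q) (u : F p) :
  a q (fmor F h u) = fmor G h (a p u).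
Proof. exact: (congr1 (@^~ u) (naturality a h)). Qed.

Definition representable (p : P) : functor (poset_category P) set_category :=
  @Functor (poset_category P) set_category (fun q => (p <= q)%O : Type)
    (fun q r qr pq => Order.POrderTheory.le_trans pq qr)
    (fun q => funext (fun h => bool_irrelevance _ _))
    (fun q r s g f => funext (fun h => bool_irrelevance _ _)).

Definition pointwise_nattrans (F G : functor (poset_category P) set_category)
    (a : forall p, F p -> G p)
    (a_nat : forall (p q : P) (h : arrow p q) u,
      a q (fmor F h u) = fmor G h (a p u)) : nattrans F G :=
  @NatTrans _ _ F G a (fun p q h => funext (a_nat p q h)).

Definition yoneda F (p : P) (u : F p) : mor (representable p : E) F :=
  @pointwise_nattrans (representable p) F
    (fun q k => fmor F (k : arrow p q) u)
    (fun q r h k => esym (restr_comp _ _ _ _)).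

Lemma yonedaE F (p : P) (u : F p) : yoneda u p (Order.POrderTheory.lexx p) = u.
Proof. exact: restr_id. Qed.

Lemma yoneda_comp F G (a : mor F G) (p : P) (u : F p) :
  a ∘ yoneda u = yoneda (component a p u).
Proof. by apply: nattrans_eq => q; apply/funext => k /=; rewrite nat_app. Qed.

(** Elements are generalised elements from representables, so a monomorphism is
    injective at each stage. *)
Lemma mono_component_inj F G (a : mor F G) (p : P) :
  is_mono a -> injective (component a p).
Proof.
move=> am u v uv; rewrite -(yonedaE u) -(yonedaE v).
suff -> : yoneda u = yoneda v by [].
by apply: am; rewrite !yoneda_comp uv.
Qed.

Lemma terminal_inhabited F (p : P) : is_terminal F -> inhabited (F p).
Proof.
move=> /(_ (representable p)) [f _].
by constructor; apply: (component f p (Order.POrderTheory.lexx p)).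
Qed.

Lemma terminal_unique F (p : P) (u v : F p) : is_terminal F -> u = v.
Proof.
move=> /(_ (representable p)) [f [_ funiq]].
have uv : yoneda u = yoneda v.
  by rewrite -(funiq (yoneda u) I) -(funiq (yoneda v) I).
by rewrite -(yonedaE u) -(yonedaE v) uv.
Qed.

Lemma pullback_element F1 F2 G W (f : mor F1 G) (g : mor F2 G) (a : mor W F1)
    (b : mor W F2) (p : P) (u : fob F1 p) (v : fob F2 p) :
  is_pullback f g a b -> component f p u = component g p v ->
  exists w : fob W p, component a p w = u /\ component b p w = v.
Proof.
move=> [_ pb] uv; case: (pb _ (yoneda u) (yoneda v)).
  by rewrite !yoneda_comp uv.
move=> h [[ha hb] _]; exists (component h p (Order.POrderTheory.lexx p)).
by split; [rewrite -[RHS](yonedaE u) -ha | rewrite -[RHS](yonedaE v) -hb].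
Qed.

Section Subfunctor.
Variables (G : E) (S : forall p : P, fob G p -> Prop).
Hypothesis Sst : forall (p q : P) (h : arrow p q) u,
  S u -> S (fmor G h u).

Definition subfunctor_restr (p q : P) (h : arrow p q)
    (u : {u : fob G p | S u}) : {u : fob G q | S u} :=
  exist _ (fmor G h (sval u)) (Sst h (svalP u)).

Lemma subfunctor_restr_id (p : P) :
  subfunctor_restr (idm (c := poset_category P) p) = id.
Proof. by apply/funext => u; apply: sval_inj; apply: restr_id. Qed.

Lemma subfunctor_restr_comp (p q r : P)
    (k : arrow q r) (h : arrow p q) :
  subfunctor_restr (k ∘ h) = subfunctor_restr k \o subfunctor_restr h.
Proof. apply/funext => u; apply: sval_inj =>  /=.
by symmetry; apply: restr_comp. Qed.

Definition subfunctor : E :=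
  @Functor (poset_category P) set_category (fun p => {u : fob G p | S u})
    subfunctor_restr subfunctor_restr_id subfunctor_restr_comp.

Definition subfunctor_incl : mor subfunctor G :=
  @NatTrans _ _ (subfunctor : functor _ _) (G : functor _ _)
    (fun p => @sval _ _ : mor (c := set_category) _ _)
    (fun p q h => erefl).

Lemma subfunctor_incl_mono : is_mono subfunctor_incl.
Proof.
move=> W f g fg; apply: nattrans_eq => p; apply/funext => u; apply: sval_inj.
exact: (congr1 (@^~ u) (component_eq p fg)).
Qed.

Lemma subfunctor_lift F (f : mor F G) :
  (forall p u, S (component f p u)) -> factors_through f subfunctor_incl.
Proof.
move=> fS; pose lift p u : subfunctor p := exist _ (component f p u) (fS p u).
have lift_nat (p q : P) (h : arrow p q) u :
    lift q (fmor F h u) = fmor subfunctor h (lift p u).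
  by apply: sval_inj; apply: nat_app.
exists (pointwise_nattrans lift_nat).
exact: nattrans_eq.
Qed.

Lemma factors_subfunctor F (f : mor F G) (p : P) u :
  factors_through f subfunctor_incl -> S (component f p u).
Proof. by move=> [h ->]; apply: (svalP (component h p u)). Qed.

End Subfunctor.

(** Images and unions in [[P, Set]] are computed pointwise: compare with the
    subfunctor of the elements that are attained. *)
Lemma image_surjective F G (f : mor F G) (p : P) (v : fob G p) :
  is_image f (idm G) -> exists u, component f p u = v.
Proof.
pose S (q : P) (w : fob G q) := exists u, component f q u = w.
have Sst : forall (q r : P) (h : arrow q r) w,
    S q w -> S r (fmor G h w).
  by move=> q r h _ [u <-]; exists (fmor F h u); apply: nat_app.
move=> [_ _ /(_ _ (subfunctor_incl Sst) (@subfunctor_incl_mono _ _ Sst)) im].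
apply: (@factors_subfunctor _ S Sst G (idm G) p v); apply: im.
by apply: subfunctor_lift => q u; exists u.
Qed.

Lemma union_cover F1 F2 G (f1 : mor F1 G) (f2 : mor F2 G) (p : P)
    (v : fob G p) :
  is_union f1 f2 (idm G) ->
  (exists u, component f1 p u = v) \/ (exists u, component f2 p u = v).
Proof.
pose S (q : P) (w : fob G q) :=
  (exists u, component f1 q u = w) \/ (exists u, component f2 q u = w).
have Sst : forall (q r : P) (h : arrow q r) w,
    S q w -> S r (fmor G h w).
  move=> q r h _ [[u <-]|[u <-]].
    by left; exists (fmor F1 h u); apply: nat_app.
  by right; exists (fmor F2 h u); apply: nat_app.
move=> [_ _ _ /(_ _ (subfunctor_incl Sst) (@subfunctor_incl_mono _ _ Sst)) un].
apply: (@factors_subfunctor _ S Sst G (idm G) p v); apply: un.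
  by apply: subfunctor_lift => q u; left; exists u.
by apply: subfunctor_lift => q u; right; exists u.
Qed.

Lemma least_empty F G (f : mor F G) (p : P) :
  is_least_subobject f -> fob F p -> False.
Proof.
have Sst : forall (q r : P) (h : arrow q r) (w : fob G q),
    False -> False by [].
move=> [_ /(_ _ (subfunctor_incl Sst) (@subfunctor_incl_mono _ _ Sst)) lf] u.
exact: (@factors_subfunctor _ _ Sst F f p u).
Qed.

End Copresheaves.

(** * Substitutions and extents *)

Ltac conjunct :=
  first [ exact: prov_id
        | apply: prov_cut (prov_and_l _ _) _; conjunct
        | apply: prov_cut (prov_and_r _ _) _; conjunct ].

Section Substitutions.
Variable S : signature.
Implicit Types G D : ctx S.

Definition nil_subst G : subst [::] G := fun A v =>
  match v in var G' A'
    return match G' with [::] => term G A' | _ => unit end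
  with
  | vz _ _ => tt
  | vs _ _ _ _ => tt
  end.

Lemma nil_substE G (s : subst [::] G) : s = nil_subst G.
Proof.
apply: subst_eq => A v.
exact: (match v as v' in var G' A' return
  match G' return var G' A' -> Prop with
  | [::] => fun w => s A' w = nil_subst G w | _ => fun _ => True end v' with
  vz _ _ => I | vs _ _ _ _ => I end).
Qed.

Definition weaken G (sigma : formula ([::] : ctx S)) : formula G :=
  fsub (nil_subst G) sigma.

Lemma fsub_weaken G D (s : subst G D) sigma :
  fsub s (weaken G sigma) = weaken D sigma.
Proof. by rewrite /weaken fsub_comp (nil_substE (scomp _ _)). Qed.

Lemma weaken_nil sigma : weaken [::] sigma = sigma.
Proof. by rewrite /weaken -(nil_substE (sid [::])) fsub_id. Qed.

Definition point A G (t : term G A) : subst [:: A] G := scons t (nil_subst G).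

Lemma point_eta A G (s : subst [:: A] G) : s = point (s A (vz _ _)).
Proof. by rewrite -[LHS](scons_eta s) (nil_substE (scomp _ s)). Qed.

Lemma scomp_point A G D (t : term G A) (s : subst G D) :
  scomp (point t) s = point (tsub s t).
Proof. by rewrite [LHS]point_eta. Qed.

End Substitutions.

Arguments nil_subst {S} G.

Local Notation "p |-- q" := (prov p q) (at level 70).

Section Extents.
Variable T : coherent_theory.
Implicit Types D E : ctx T.
Implicit Types U V W X Y : pretopos_ob T.

Local Notation sentence := (formula ([::] : ctx T)).
Local Notation PT := (classifying_pretopos T).

Lemma prov_weaken D (sigma tau : sentence) :
  sigma |-- tau -> weaken D sigma |-- weaken D tau.
Proof. exact: prov_subst. Qed.

(** The sentence saying that [X] is inhabited: the image of [X] in the terminal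
    object. *)
Definition extent X : sentence :=
  bigor (fun i => exs (fsub (proj_l (octx i) [::]) (@odom T X i))).

Lemma extent_intro X (i : 'I_(arity X)) D (s : subst (octx i) D) :
  fsub s (odom i) |-- weaken D (extent X).
Proof.
rewrite /weaken /extent fsub_bigor; apply: prov_cut (prov_bigor_intro _ i).
apply: prov_cut (prov_exs_intro_sub _ s _).
by rewrite fsub_comp proj_l_spair; apply: prov_id.
Qed.

Lemma extent_elim X D (H q : formula D) :
  H |-- weaken D (extent X) ->
  (forall i E (w : subst D E) (u : subst (octx i) E),
    And (fsub w H) (fsub u (@odom T X i)) |-- fsub w q) ->
  H |-- q.
Proof.
move=> Hs Hq; apply: prov_cut_and Hs _.
rewrite /weaken /extent fsub_bigor; apply: prov_bigor_elim => i.
apply: prov_exs_elim.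
by rewrite fsub_comp proj_l_spair; apply: Hq.
Qed.

Lemma extent_functional X Y (g : matrix X Y) :
  functional g -> extent X |-- extent Y.
Proof.
move=> gF; rewrite -(weaken_nil (extent Y)).
apply: (@extent_elim X); first by rewrite weaken_nil; apply: prov_id.
move=> i E w u; rewrite fsub_weaken.
apply: (functional_total_elim gF (i := i) (s := u)); first by conjunct.
move=> k F r v; rewrite fsub_weaken.
apply: prov_cut (extent_intro v).
apply: prov_cut (prov_and_r _ _) _.
by apply: prov_cut (functional_dom gF _ _) _; conjunct.
Qed.

Lemma extent_mor X Y : mor (c := PT) X Y -> extent X |-- extent Y.
Proof.
move=> f; have [g [gF _]] := pretopos_class_surj f.
exact: extent_functional gF.
Qed.

(** * Sentences and subterminal objects *)

Program Definition sent (sigma : sentence) : pretopos_ob T :=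
  @PretoposOb T 1 (fun _ => [::]) (fun _ => sigma) (fun _ _ => sigma) _ _ _ _.
Next Obligation.
move=> sigma i j D s t; rewrite (nil_substE s) (nil_substE t).
by apply: prov_and; apply: prov_id.
Qed.
Next Obligation. by move=> *; apply: prov_id. Qed.
Next Obligation.
move=> sigma i j D s t; rewrite /= (nil_substE s) (nil_substE t).
exact: prov_id.
Qed.
Next Obligation. by move=> *; apply: prov_and_r. Qed.

Lemma extent_sent_l sigma : extent (sent sigma) |-- sigma.
Proof.
rewrite -{2}(weaken_nil sigma).
apply: (@extent_elim (sent sigma)); first by rewrite weaken_nil; apply: prov_id.
by move=> i E w u; rewrite fsub_weaken /= (nil_substE u); conjunct.
Qed.

Lemma extent_sent_r sigma : sigma |-- extent (sent sigma).
Proof.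
rewrite -{1}(weaken_nil sigma) -(weaken_nil (extent _)).
exact: (@extent_intro (sent sigma) ord0 _ (nil_subst [::])).
Qed.

(** Functional relations are equal as soon as one contains the other: totality
    of the smaller and single-valuedness of the larger give the converse. *)
Lemma mor_le X Y (a b : mor (c := PT) X Y) (g h : matrix X Y)
    (gF : functional g) (hF : functional h) :
  a = pretopos_class gF -> b = pretopos_class hF ->
  (forall i k D (s : subst (octx i) D) (t : subst (octx k) D),
    inst (g i k) s t |-- inst (h i k) s t) ->
  a = b.
Proof.
move=> -> -> gh; apply/pretopos_class_eq; apply: matrix_equiv_inst => i k D s t.
split; first exact: gh.
apply: (functional_total_elim gF (i := i) (s := s)).
  exact: prov_cut (functional_dom hF s t) (prov_and_l _ _).
move=> k' E w u; rewrite !inst_sub.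
apply: (functional_use_eqv (i := i) (k := k') (s := scomp s w) (t := u) gF).
- by conjunct.
- by apply: (functional_refl_l (t := u) gF); conjunct.
apply: (functional_use_single (i := i) (s := scomp s w) hF); last by conjunct.
by apply: prov_cut (gh _ _ _ _ _); conjunct.
Qed.

Lemma sent_subterminal sigma : is_subterminal (C := PT) (sent sigma).
Proof.
move=> W f f'.
have [g [gF fg]] := pretopos_class_surj f.
have [g' [gF' fg']] := pretopos_class_surj f'.
apply: mor_le fg fg' _ => i k D s t.
apply: (functional_total_elim gF' (i := i) (s := s)).
  exact: prov_cut (functional_dom gF s t) (prov_and_l _ _).
move=> k' E w u; rewrite (ord1 k) (ord1 k') in t u *.
rewrite !fsub_comp spair_comp.
by rewrite (nil_substE u) (nil_substE (scomp t w)); conjunct.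
Qed.

Lemma mor_to_sent X sigma :
  extent X |-- sigma -> inhabited (mor (c := PT) X (sent sigma)).
Proof.
move=> Xs.
pose g : matrix X (sent sigma) :=
  fun i k => fsub (proj_l (octx i) [::]) (odom i).
have gE i k D (s : subst (octx i) D) (t : subst [::] D) :
    inst (g i k) s t = fsub s (odom i) by rewrite fsub_comp proj_l_spair.
suff gF : functional g by constructor; apply: pretopos_class gF.
split.
- move=> i k D s t; rewrite gE; apply: prov_and; first exact: prov_id.
  rewrite (nil_substE t); apply: prov_cut (extent_intro s) (prov_weaken _ Xs).
- move=> i i' k k' D s s' t t'; rewrite !gE.
  by apply: prov_cut (prov_and_r _ _) _; apply: prov_cut (prov_and_l _ _) _;
     apply: prov_cut (oeqv_dom _ _) (prov_and_r _ _).
- move=> i k k' D s t t'; rewrite !gE (nil_substE (spair t t')).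
  apply: prov_cut (prov_and_l _ _) _.
  exact: prov_cut (extent_intro s) (prov_weaken _ Xs).
- move=> i; rewrite -[X in _ |-- X]fsub_id.
  apply: (@functional_total_intro T X (sent sigma) g i ord0 _ _ (nil_subst _)).
  by rewrite gE fsub_id; apply: prov_id.
Qed.

Section Equivalence.
Variables (Y : pretopos_ob T) (D : ctx T) (H : formula D).
Variables (a b c : 'I_(arity Y)).
Variables (s : subst (octx a) D) (t : subst (octx b) D) (u : subst (octx c) D).

Lemma eqv_chain :
  H |-- inst (oeqv a b) s t -> H |-- inst (oeqv b c) t u ->
  H |-- inst (oeqv a c) s u.
Proof.
by move=> ab bc; apply: prov_cut (oeqv_trans s t u); apply: prov_and.
Qed.

Lemma eqv_flip : H |-- inst (oeqv a b) s t -> H |-- inst (oeqv b a) t s.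
Proof. by move=> ab; apply: prov_cut (oeqv_sym s t). Qed.

Lemma eqv_dom_l : H |-- inst (oeqv a b) s t -> H |-- fsub s (odom a).
Proof.
move=> ab; apply: prov_cut ab _.
exact: prov_cut (oeqv_dom s t) (prov_and_l _ _).
Qed.

Lemma eqv_dom_r : H |-- inst (oeqv a b) s t -> H |-- fsub t (odom b).
Proof.
move=> ab; apply: prov_cut ab _.
exact: prov_cut (oeqv_dom s t) (prov_and_r _ _).
Qed.

End Equivalence.

Section SelfProduct.
Variables (X : pretopos_ob T) (i j : 'I_(arity X)).
Local Notation l := (proj_l (octx i) (octx j)).
Local Notation r := (proj_r (octx i) (octx j)).
Local Notation c := (octx i ++ octx j).

(** The product of the components [i] and [j] of [X], with the equivalence
    relation induced by that of [X], is the test object against which the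
    subterminality of [X] is used. *)
Program Definition pair_ob : pretopos_ob T :=
  @PretoposOb T 1 (fun _ => c)
    (fun _ => And (fsub l (odom i)) (fsub r (odom j)))
    (fun _ _ => And
      (inst (oeqv i i) (scomp l (proj_l c c)) (scomp l (proj_r c c)))
      (inst (oeqv j j) (scomp r (proj_l c c)) (scomp r (proj_r c c)))) _ _ _ _.
Next Obligation.
move=> n n' D s t /=.
rewrite !inst_sub !scompA !proj_l_spair !proj_r_spair !fsub_comp.
apply: prov_cut (prov_and_mono (oeqv_dom _ _) (oeqv_dom _ _)) _.
by apply: prov_and; apply: prov_and; conjunct.
Qed.
Next Obligation.
move=> n D s /=.
rewrite !inst_sub !scompA !proj_l_spair !proj_r_spair !fsub_comp.
by apply: prov_and_mono; apply: oeqv_refl.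
Qed.
Next Obligation.
move=> n n' D s t /=.
rewrite !inst_sub !scompA !proj_l_spair !proj_r_spair.
by apply: prov_and_mono; apply: oeqv_sym.
Qed.
Next Obligation.
move=> n n' n'' D s t u /=.
rewrite !inst_sub !scompA !proj_l_spair !proj_r_spair.
apply: prov_and.
  by apply: prov_cut (oeqv_trans _ (scomp l t) _); apply: prov_and; conjunct.
by apply: prov_cut (oeqv_trans _ (scomp r t) _); apply: prov_and; conjunct.
Qed.

Definition pair_fst : matrix pair_ob X := fun _ k =>
  And (fsub (scomp r (proj_l c (octx k))) (odom j))
      (inst (oeqv i k) (scomp l (proj_l c (octx k))) (proj_r c (octx k))).

Definition pair_snd : matrix pair_ob X := fun _ k =>
  And (fsub (scomp l (proj_l c (octx k))) (odom i))
      (inst (oeqv j k) (scomp r (proj_l c (octx k))) (proj_r c (octx k))).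

Lemma pair_fstE n k D (s : subst c D) (t : subst (octx k) D) :
  inst (pair_fst n k) s t =
  And (fsub (scomp r s) (odom j)) (inst (oeqv i k) (scomp l s) t).
Proof.
by rewrite /= inst_sub fsub_comp !scompA !proj_l_spair !proj_r_spair.
Qed.

Lemma pair_sndE n k D (s : subst c D) (t : subst (octx k) D) :
  inst (pair_snd n k) s t =
  And (fsub (scomp l s) (odom i)) (inst (oeqv j k) (scomp r s) t).
Proof.
by rewrite /= inst_sub fsub_comp !scompA !proj_l_spair !proj_r_spair.
Qed.

Lemma pair_eqvE n n' D (s t : subst c D) :
  inst (@oeqv T pair_ob n n') s t =
  And (inst (oeqv i i) (scomp l s) (scomp l t))
      (inst (oeqv j j) (scomp r s) (scomp r t)).
Proof. by rewrite /= !inst_sub !scompA !proj_l_spair !proj_r_spair. Qed.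

Lemma pair_fst_functional : functional pair_fst.
Proof.
split.
- move=> n k D s t; rewrite pair_fstE /= !fsub_comp.
  apply: prov_and; last by apply: eqv_dom_r (prov_and_r _ _).
  apply: prov_and; last by conjunct.
  by apply: eqv_dom_l (prov_and_r _ _).
- move=> n n' k k' D s s' t t'; rewrite !pair_fstE pair_eqvE; apply: prov_and.
    by apply: (eqv_dom_r (a := j) (b := j) (s := (scomp r s))); conjunct.
  apply: (eqv_chain (t := scomp l s)); first by apply: eqv_flip; conjunct.
  by apply: (eqv_chain (t := t)); conjunct.
- move=> n k k' D s t t'; rewrite !pair_fstE.
  by apply: (eqv_chain (t := scomp l s)); first apply: eqv_flip; conjunct.
- move=> n; rewrite -[X in _ |-- X]fsub_id.
  apply: (@functional_total_intro T pair_ob X pair_fst n i _ _ l).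
  rewrite pair_fstE !scomp_idr; apply: prov_and; first by conjunct.
  by apply: prov_cut (prov_and_l _ _) (oeqv_refl _).
Qed.

Lemma pair_snd_functional : functional pair_snd.
Proof.
split.
- move=> n k D s t; rewrite pair_sndE /= !fsub_comp.
  apply: prov_and; last by apply: eqv_dom_r (prov_and_r _ _).
  apply: prov_and; first by conjunct.
  by apply: eqv_dom_l (prov_and_r _ _).
- move=> n n' k k' D s s' t t'; rewrite !pair_sndE pair_eqvE; apply: prov_and.
    by apply: (eqv_dom_r (a := i) (b := i) (s := (scomp l s))); conjunct.
  apply: (eqv_chain (t := scomp r s)); first by apply: eqv_flip; conjunct.
  by apply: (eqv_chain (t := t)); conjunct.
- move=> n k k' D s t t'; rewrite !pair_sndE.
  by apply: (eqv_chain (t := scomp r s)); first apply: eqv_flip; conjunct.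
- move=> n; rewrite -[X in _ |-- X]fsub_id.
  apply: (@functional_total_intro T pair_ob X pair_snd n j _ _ r).
  rewrite pair_sndE !scomp_idr; apply: prov_and; first by conjunct.
  by apply: prov_cut (prov_and_r _ _) (oeqv_refl _).
Qed.

(** In a subterminal object any two elements are provably equivalent, because
    the two projections of [pair_ob] agree. *)
Lemma subterminal_eqv D (s : subst (octx i) D) (t : subst (octx j) D) :
  is_subterminal (C := PT) X ->
  And (fsub s (odom i)) (fsub t (odom j)) |-- inst (oeqv i j) s t.
Proof.
move=> /(_ pair_ob (pretopos_class pair_fst_functional)
             (pretopos_class pair_snd_functional)).
move=> /pretopos_class_eq /(_ ord0 i).
move=> [/(prov_subst (spair (spair s t) s)) fst_snd _].
rewrite pair_fstE pair_sndE !proj_l_spair !proj_r_spair in fst_snd.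
apply: eqv_flip; apply: prov_cut (prov_cut _ fst_snd) (prov_and_r _ _).
apply: prov_and; first by conjunct.
exact: prov_cut (prov_and_l _ _) (oeqv_refl s).
Qed.

End SelfProduct.

(** With all elements of [X] identified, the relation holding between the point
    and every element of [X] is functional where [X] is inhabited. *)
Lemma mor_from_sent sigma X : is_subterminal (C := PT) X ->
  sigma |-- extent X -> inhabited (mor (c := PT) (sent sigma) X).
Proof.
move=> Xsub sX.
pose g : matrix (sent sigma) X :=
  fun _ k => And (weaken (octx k) sigma) (odom k).
have gE n k D (s : subst [::] D) (t : subst (octx k) D) :
    inst (g n k) s t = And (weaken D sigma) (fsub t (odom k)).
  by rewrite /= fsub_weaken.
suff gF : functional g by constructor; apply: pretopos_class gF.
split.
- move=> n k D s t; rewrite gE (nil_substE s); exact: prov_id.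
- move=> n n' k k' D s s' t t'; rewrite !gE; apply: prov_and; first by conjunct.
  by apply: (eqv_dom_r (a := k) (b := k') (s := t)); conjunct.
- move=> n k k' D s t t'; rewrite !gE.
  by apply: prov_cut (subterminal_eqv t t' Xsub); apply: prov_and; conjunct.
- move=> n; rewrite -[X in _ |-- X]fsub_id.
  apply: (@extent_elim X).
    by rewrite weaken_nil.
  move=> k E w u; rewrite !fsub_comp.
  apply: (@functional_total_intro T (sent sigma) X g n k _ _ u).
  by rewrite gE (nil_substE w); conjunct.
Qed.

End Extents.

(** * Comprehensions in one variable *)

Section Comprehensions.
Variable T : coherent_theory.
Implicit Types D E : ctx T.
Implicit Types U V W X Y : pretopos_ob T.

Local Notation sentence := (formula ([::] : ctx T)).
Local Notation PT := (classifying_pretopos T).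

Lemma mor_factors_sent X Y sigma (f : mor (c := PT) X (sent sigma))
    (m : mor (c := PT) Y (sent sigma)) (h : mor (c := PT) X Y) :
  factors_through f m.
Proof. by exists h; apply: sent_subterminal. Qed.

Lemma id_mono X : is_mono (C := PT) (idm (X : PT)).
Proof. by move=> W f g; rewrite !compose_id_l. Qed.

Lemma sent_Top_terminal : is_terminal (C := PT) (sent (Top _)).
Proof.
move=> X; have [f] := @mor_to_sent T X (Top _) (prov_top _).
by exists f; split=> // g _; apply: sent_subterminal.
Qed.

(** The sentence [extent X] is the image of [X] in the terminal object, here for
    a provably inhabited [X]. *)
Lemma sent_Top_image X (f : mor (c := PT) X (sent (Top _))) :
  Top _ |-- extent X -> is_image f (idm (sent (Top _) : PT)).
Proof.
move=> TX; split; first exact: id_mono.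
  by exists f; rewrite compose_id_l.
move=> J m mm [h _].
have Jsub : is_subterminal (C := PT) J.
  by move=> W a b; apply: mm; apply: sent_subterminal.
have [k] := mor_from_sent Jsub (prov_cut TX (extent_mor h)).
exact: mor_factors_sent k.
Qed.

Lemma fsub_And D E (s : subst D E) (p q : formula D) :
  fsub s (And p q) = And (fsub s p) (fsub s q).
Proof. by []. Qed.

Lemma prov_or_elim D (H p q r : formula D) :
  H |-- Or p q -> And H p |-- r -> And H q |-- r -> H |-- r.
Proof.
move=> Hpq pr qr; apply: prov_cut_and Hpq _.
by apply: prov_cut (prov_distr _ _ _) (prov_or _ _).
Qed.

Section Equality.
Variable A : Defs.sort T.

Lemma prov_Eq_subst D (t u : term D A) (phi : formula [:: A]) (H : formula D) :
  H |-- Eq t u -> H |-- fsub (point t) phi -> H |-- fsub (point u) phi.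
Proof.
move=> tu pt.
pose phi' := fsub (point (tvar (vz D A))) phi.
have phiE v : fsub (scons v (sid D)) phi' = fsub (point v) phi.
  by rewrite /phi' fsub_comp scomp_point.
rewrite -(phiE u). apply: (prov_cut _ (prov_eq_subst t u phi')).
by apply: prov_and; rewrite ?phiE.
Qed.

Lemma prov_Eq_refl D (t : term D A) (H : formula D) : H |-- Eq t t.
Proof. exact: prov_cut (prov_top _) (prov_eq_refl t). Qed.

Lemma prov_Eq_trans D (t u v : term D A) (H : formula D) :
  H |-- Eq t u -> H |-- Eq u v -> H |-- Eq t v.
Proof.
move=> tu uv.
pose p := Eq (tsub (shift A D) t) (tvar (vz D A)).
have pE w : fsub (scons w (sid D)) p = Eq t w.
  by rewrite /p /= tsub_comp shift_scons tsub_id.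
rewrite -(pE v); apply: (prov_cut _ (prov_eq_subst u v p)).
by apply: prov_and; rewrite ?pE.
Qed.

Lemma prov_Eq_sym D (t u : term D A) (H : formula D) :
  H |-- Eq t u -> H |-- Eq u t.
Proof.
move=> tu.
pose p := Eq (tvar (vz D A)) (tsub (shift A D) t).
have pE w : fsub (scons w (sid D)) p = Eq w t.
  by rewrite /p /= tsub_comp shift_scons tsub_id.
rewrite -(pE u); apply: (prov_cut _ (prov_eq_subst t u p)).
by apply: prov_and; rewrite ?pE; [|apply: prov_Eq_refl].
Qed.

Definition compr_eqv (phi : formula [:: A]) : formula ([:: A] ++ [:: A]) :=
  And (fsub (proj_l [:: A] [:: A]) phi)
    (Eq (proj_l [:: A] [:: A] A (vz [::] A))
        (proj_r [:: A] [:: A] A (vz [::] A))).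

Lemma compr_eqvE phi D (s t : subst [:: A] D) :
  inst (compr_eqv phi) s t =
  And (fsub s phi) (Eq (s A (vz [::] A)) (t A (vz [::] A))).
Proof. by rewrite /= fsub_comp proj_l_spair. Qed.

Lemma compr_eqv_r phi D (s t : subst [:: A] D) (H : formula D) :
  H |-- inst (compr_eqv phi) s t -> H |-- fsub t phi.
Proof.
rewrite compr_eqvE => st; rewrite (point_eta t).
apply: prov_Eq_subst (prov_cut st (prov_and_r _ _)) _.
by rewrite -point_eta; apply: prov_cut st (prov_and_l _ _).
Qed.

(** The object [{x : A. phi}] of the syntactic category. *)
Program Definition compr (phi : formula [:: A]) : pretopos_ob T :=
  @PretoposOb T 1 (fun _ => [:: A]) (fun _ => phi)
    (fun _ _ => compr_eqv phi) _ _ _ _.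
Next Obligation.
move=> phi i j D s t; apply: prov_and; last exact: compr_eqv_r (prov_id _).
by rewrite compr_eqvE; apply: prov_and_l.
Qed.
Next Obligation.
move=> phi i D s; rewrite compr_eqvE; apply: prov_and; first exact: prov_id.
exact: prov_Eq_refl.
Qed.
Next Obligation.
move=> phi i j D s t.
rewrite [X in _ |-- X]compr_eqvE; apply: prov_and.
  exact: compr_eqv_r (prov_id _).
by rewrite compr_eqvE; apply: prov_Eq_sym; conjunct.
Qed.
Next Obligation.
move=> phi i j k D s t u; rewrite !compr_eqvE.
apply: prov_and; first by conjunct.
by apply: (prov_Eq_trans (u := t A (vz [::] A))); conjunct.
Qed.

Lemma incl_functional phi psi : phi |-- psi ->
  @functional T (compr phi) (compr psi) (fun _ _ => compr_eqv phi).
Proof.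
move=> pq; have [dom eqv single total] := functional_id (compr phi).
split=> //.
- move=> i k D s t; apply: prov_cut (dom i k D s t) _.
  by apply: prov_and_mono; [apply: prov_id | apply: prov_subst].
- move=> i i' k k' D s s' t t'; apply: prov_cut (eqv i i' k k' D s s' t t').
  apply: prov_and; first by conjunct.
  apply: prov_and; first by conjunct.
  rewrite [X in _ |-- X]compr_eqvE; apply: prov_and.
    by apply: (@compr_eqv_r _ _ s t); conjunct.
  by rewrite !compr_eqvE; conjunct.
- move=> i k k' D s t t'; apply: prov_cut (single i k k' D s t t') _.
  rewrite !compr_eqvE.
  by apply: prov_and_mono; [apply: prov_subst | apply: prov_id].
Qed.

Definition incl phi psi (pq : phi |-- psi) :
    mor (c := PT) (compr phi) (compr psi) :=
  pretopos_class (incl_functional pq).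

(** All comprehensions over [A] live in the same context and [incl] is given by
    the identity relation of its domain, so composing with [incl] keeps the
    matrix of a morphism.  Factoring through [incl] is thus a matter of checking
    that the same matrix lands in the smaller comprehension. *)
Lemma incl_comp phi psi (pq : phi |-- psi) X (g : matrix X (compr phi))
    (gF : functional g) (gF' : @functional T X (compr psi) g) :
  compose (c := PT) (incl pq) (pretopos_class gF) = pretopos_class gF'.
Proof.
rewrite /= pretopos_comp_class; apply/pretopos_class_eq.
exact: (@matrix_comp_id_l T X (compr phi)).
Qed.

Lemma functional_compr phi psi X (g : matrix X (compr phi)) :
  functional g -> (forall i k, g i k |-- fsub (proj_r (octx i) [:: A]) psi) ->
  @functional T X (compr psi) g.
Proof.
move=> gF g_psi; have [dom eqv single total] := gF.
have gr i k D (s : subst (octx i) D) (t : subst [:: A] D) :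
    inst (g i k) s t |-- fsub t psi.
  have := prov_subst (spair s t) (g_psi i k).
  by rewrite fsub_comp proj_r_spair.
split=> //.
- move=> i k D s t; apply: prov_and; last exact: gr.
  exact: prov_cut (dom i k D s t) (prov_and_l _ _).
- move=> i i' k k' D s s' t t'; apply: prov_cut (eqv i i' k k' D s s' t t').
  apply: prov_and; first by conjunct.
  apply: prov_and; first by conjunct.
  rewrite [X in _ |-- X]compr_eqvE; apply: prov_and.
    apply: prov_cut (prov_and_l _ _) _.
    exact: prov_cut (dom i k D s t) (prov_and_r _ _).
  by rewrite !compr_eqvE; conjunct.
- move=> i k k' D s t t'; rewrite compr_eqvE; apply: prov_and.
    by apply: prov_cut (prov_and_l _ _) (gr _ _ _ _ _).
  by apply: prov_cut (single i k k' D s t t') _; rewrite compr_eqvE; conjunct.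
Qed.

Lemma compr_dom phi X (g : matrix X (compr phi)) i k :
  functional g -> g i k |-- fsub (proj_r (octx i) [:: A]) phi.
Proof.
move=> gF; have := @functional_dom _ _ _ g gF i k _
  (proj_l (octx i) [:: A]) (proj_r (octx i) [:: A]).
by rewrite spair_proj fsub_id => h; apply: prov_cut h (prov_and_r _ _).
Qed.

Lemma incl_mono phi psi (pq : phi |-- psi) : is_mono (incl pq).
Proof.
move=> X f f'.
have [g [gF ->]] := pretopos_class_surj f.
have [g' [gF' ->]] := pretopos_class_surj f'.
have gpsi h : @functional T X (compr phi) h -> @functional T X (compr psi) h.
  move=> hF; apply: (functional_compr hF) => i k.
  exact: prov_cut (compr_dom _ _ hF) (prov_subst _ pq).
rewrite (incl_comp pq gF (gpsi _ gF)) (incl_comp pq gF' (gpsi _ gF')).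
by move=> /pretopos_class_eq gg; apply/pretopos_class_eq.
Qed.

Lemma incl_factor phi psi (pq : phi |-- psi) X
    (f : mor (c := PT) X (compr psi)) g (gF : functional g) :
  f = pretopos_class gF ->
  (forall i k, g i k |-- fsub (proj_r (octx i) [:: A]) phi) ->
  exists h : mor (c := PT) X (compr phi), incl pq ∘ h = f.
Proof.
move=> -> gphi; have gF' := functional_compr gF gphi.
by exists (pretopos_class gF'); apply: incl_comp.
Qed.

Lemma incl_incl phi psi chi (pq : phi |-- psi) (qr : psi |-- chi)
    (pr : phi |-- chi) :
  incl qr ∘ incl pq = incl pr.
Proof. exact: incl_comp. Qed.

(** Conjunction is intersection. *)
Lemma incl_pullback phi psi chi theta (tp : theta |-- phi) (tq : theta |-- psi)
    (pr : phi |-- chi) (qr : psi |-- chi) :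
  And phi psi |-- theta ->
  is_pullback (incl pr) (incl qr) (incl tp) (incl tq).
Proof.
move=> pqt; split; first by rewrite !(incl_incl _ _ (prov_cut tp pr)).
move=> X a b ab.
have [g [gF aE]] := pretopos_class_surj a.
have [g' [gF' bE]] := pretopos_class_surj b.
have gF1 : @functional T X (compr chi) g.
  apply: (functional_compr gF) => i k.
  exact: prov_cut (compr_dom _ _ gF) (prov_subst _ pr).
have gF1' : @functional T X (compr chi) g'.
  apply: (functional_compr gF') => i k.
  exact: prov_cut (compr_dom _ _ gF') (prov_subst _ qr).
have gg : matrix_equiv g g'.
  move: (ab); rewrite aE bE (incl_comp pr gF gF1) (incl_comp qr gF' gF1').
  by move/pretopos_class_eq.
have [i k|h hE] := incl_factor tp aE.
  apply: prov_cut (prov_subst _ pqt).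
  apply: prov_and; first exact: (compr_dom _ _ gF).
  by apply: prov_cut (gg i k).1 _; exact: (compr_dom _ _ gF').
exists h; split; last first.
  by move=> h' [h'E _]; apply: (incl_mono (pq := tp)); rewrite hE h'E.
split=> //; apply: (incl_mono (pq := qr)).
rewrite compose_assoc (incl_incl _ _ (prov_cut tp pr)) -ab -hE.
by rewrite compose_assoc (incl_incl _ _ (prov_cut tp pr)).
Qed.

(** Conjunction with a sentence is product with the corresponding subterminal
    object. *)
Lemma sent_pullback phi theta sigma (tp : theta |-- phi)
    (f : mor (c := PT) (compr phi) (sent (Top _)))
    (g : mor (c := PT) (sent sigma) (sent (Top _)))
    (b : mor (c := PT) (compr theta) (sent sigma)) :
  And phi (weaken _ sigma) |-- theta ->
  is_pullback f g (incl tp) b.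
Proof.
move=> pst; split; first exact: sent_subterminal.
move=> X a c _; have [h [hF aE]] := pretopos_class_surj a.
have [i k|k kE] := incl_factor tp aE.
  apply: prov_cut (prov_subst _ pst).
  apply: prov_and; first exact: (compr_dom _ _ hF).
  have := @functional_dom _ _ _ h hF i k _
    (proj_l (octx i) [:: A]) (proj_r (octx i) [:: A]).
  rewrite spair_proj fsub_id => hd.
  apply: prov_cut (prov_cut hd (prov_and_l _ _)) _.
  rewrite -/(fsub (proj_r (octx i) (octx (p := compr phi) k))
               (weaken [:: A] sigma)) fsub_weaken.
  apply: prov_cut (extent_intro _) _; apply: prov_weaken.
  exact: prov_cut (extent_mor c) (extent_sent_l _).
exists k; split; first by split=> //; apply: sent_subterminal.
by move=> k' [k'E _]; apply: (incl_mono (pq := tp)); rewrite kE k'E.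
Qed.

(** From the empty comprehension the empty relation is functional to any
    object. *)
Lemma compr_least phi psi (pq : phi |-- psi) :
  phi |-- Bot _ -> is_least_subobject (incl pq).
Proof.
move=> pB; split; first exact: incl_mono.
move=> J m _.
have absurd (D : ctx T) (s : subst [:: A] D) (q H : formula D) :
    H |-- fsub s phi -> H |-- q.
  move=> Hp; apply: prov_cut Hp _.
  exact: prov_cut (prov_subst s pB) (prov_bot _).
pose g : matrix (compr phi) J := fun _ _ => Bot _.
have gF : functional g.
  split.
  - by move=> *; apply: prov_bot.
  - by move=> *; apply: prov_and_l.
  - by move=> *; apply: prov_cut (prov_and_l _ _) (prov_bot _).
  - by move=> i; apply: prov_cut pB (prov_bot _).
exists (pretopos_class gF).
have [h [hF ->]] :=
  pretopos_class_surj (m ∘ (pretopos_class gF : mor (c := PT) _ _)).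
apply: mor_le erefl erefl _ => i k D s t.
by apply: (absurd _ s); rewrite compr_eqvE; apply: prov_and_l.
Qed.

Lemma compr_dom_l phi Y (g : matrix (compr phi) Y) (i : 'I_1) k D
    (s : subst [:: A] D) (t : subst (octx k) D) (H : formula D) :
  functional g -> H |-- inst (g i k) s t -> H |-- fsub s phi.
Proof.
move=> gF Hg; apply: prov_cut Hg _.
exact: prov_cut (functional_dom gF s t) (prov_and_l _ _).
Qed.

Lemma compr_transport phi Y (g : matrix (compr phi) Y) (i i' : 'I_1) k k' D
    (s s' : subst [:: A] D) (t : subst (octx k) D) (t' : subst (octx k') D)
    (H : formula D) :
  functional g -> H |-- inst (g i k) s t ->
  H |-- Eq (s A (vz [::] A)) (s' A (vz [::] A)) ->
  H |-- inst (oeqv k k') t t' -> H |-- inst (g i' k') s' t'.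
Proof.
move=> gF Hg Hs Ht; apply: (functional_use_eqv gF Hg _ Ht).
rewrite compr_eqvE; apply: prov_and => //.
exact: compr_dom_l gF Hg.
Qed.

(** Precomposing with [incl] restricts the matrix to the smaller
    comprehension. *)
Lemma comp_incl phi psi (pq : phi |-- psi) Y (g : matrix (compr psi) Y)
    (gF : functional g) :
  exists2 h, exists hF : functional h,
    compose (c := PT) (pretopos_class gF) (incl pq) = pretopos_class hF &
  forall i k D (s : subst [:: A] D) (t : subst (octx k) D) (H : formula D),
    H |-- inst (h i k) s t <-> H |-- And (fsub s phi) (inst (g i k) s t).
Proof.
eexists.
  exists (functional_comp gF (incl_functional pq)).
  exact: pretopos_comp_class.
move=> i k D s t H; split=> Hh.
  apply: matrix_comp_use Hh _ => j E w u.
  rewrite fsub_And inst_sub compr_eqvE fsub_comp.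
  apply: prov_and; first by conjunct.
  apply: (compr_transport (i := j) (s := u) (t := scomp t w) _ gF).
  - by conjunct.
  - by apply: prov_Eq_sym; conjunct.
  - by apply: (functional_refl_r (s := u) gF); conjunct.
apply: (matrix_comp_intro (k := i) (u := s)).
  rewrite compr_eqvE; apply: prov_and; last exact: prov_Eq_refl.
  exact: prov_cut Hh (prov_and_l _ _).
exact: prov_cut Hh (prov_and_r _ _).
Qed.

(** A morphism defined on [phi] and on [psi] into a subobject [J] is glued by
    taking the disjunction of the two matrices.  It is single-valued because the
    two morphisms agree on the comprehension of [And phi psi], [J] being a
    subobject. *)
Lemma compr_union phi psi chi (pr : phi |-- chi) (qr : psi |-- chi) :
  chi |-- Or phi psi -> is_union (incl pr) (incl qr) (idm (compr chi : PT)).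
Proof.
move=> cpq; split; first exact: id_mono.
- by exists (incl pr); rewrite compose_id_l.
- by exists (incl qr); rewrite compose_id_l.
move=> J m mm [k1 k1E] [k2 k2E].
have [g1 [g1F k1g]] := pretopos_class_surj k1.
have [g2 [g2F k2g]] := pretopos_class_surj k2.
pose theta := And phi psi.
have tp : theta |-- phi by exact: prov_and_l.
have tq : theta |-- psi by exact: prov_and_r.
have k12 : k1 ∘ incl tp = k2 ∘ incl tq.
  apply: mm; rewrite !compose_assoc -k1E -k2E.
  by rewrite !(incl_incl _ _ (prov_cut tp pr)).
have agree i j k D (s : subst [:: A] D) (t : subst (octx k) D) (H : formula D) :
    H |-- fsub s psi -> H |-- inst (g1 i k) s t -> H |-- inst (g2 j k) s t.
  rewrite (ord1 i) (ord1 j) => Hs H1.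
  have [h1 [h1F e1] h1E] := comp_incl tp g1F.
  have [h2 [h2F e2] h2E] := comp_incl tq g2F.
  have : pretopos_class h1F = pretopos_class h2F by rewrite -e1 -e2 -k1g -k2g.
  move=> /pretopos_class_eq /(_ ord0 k) [h12 _].
  have /h2E H2 : H |-- inst (h2 ord0 k) s t.
    apply: prov_cut (prov_subst (spair s t) h12).
    apply/h1E; apply: prov_and => //; apply: prov_and => //.
    exact: compr_dom_l g1F H1.
  exact: prov_cut H2 (prov_and_r _ _).
pose g : matrix (compr chi) J := fun i k => Or (g1 i k) (g2 i k).
have g1s i k D (s : subst [:: A] D) (t : subst (octx k) D) :
    inst (g1 i k) s t |-- And (fsub s phi) (fsub t (odom k)) :=
  functional_dom g1F s t.
have g2s i k D (s : subst [:: A] D) (t : subst (octx k) D) :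
    inst (g2 i k) s t |-- And (fsub s psi) (fsub t (odom k)) :=
  functional_dom g2F s t.
have single12 i j k k' D (s : subst [:: A] D) (t : subst (octx k) D)
    (t' : subst (octx k') D) (H : formula D) :
    H |-- inst (g1 i k) s t -> H |-- inst (g2 j k') s t' ->
    H |-- inst (oeqv k k') t t'.
  move=> H1 H2; apply: (functional_use_single (i := j) (s := s) g2F) => //.
  apply: (agree i j k) => //; apply: prov_cut H2 _.
  exact: prov_cut (g2s _ _ _ _ _) (prov_and_l _ _).
have gE i k D (s : subst [:: A] D) (t : subst (octx k) D) :
    inst (g i k) s t = Or (inst (g1 i k) s t) (inst (g2 i k) s t) by [].
have gF : functional g.
  split.
  - move=> i k D s t; rewrite gE; apply: prov_or.
      apply: prov_cut (g1s _ _ _ _ _) _.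
      exact: prov_and_mono (prov_subst _ pr) (prov_id _).
    apply: prov_cut (g2s _ _ _ _ _) _.
    exact: prov_and_mono (prov_subst _ qr) (prov_id _).
  - move=> i i' k k' D s s' t t'; rewrite !gE.
    apply: prov_or_elim (prov_and_l _ _) _ _.
      apply: prov_cut (prov_or_l _ _).
      apply: (compr_transport (i := i) (s := s) (t := t) _ g1F).
      + by conjunct.
      + by rewrite compr_eqvE; conjunct.
      + by conjunct.
    apply: prov_cut (prov_or_r _ _).
    apply: (compr_transport (i := i) (s := s) (t := t) _ g2F).
    + by conjunct.
    + by rewrite compr_eqvE; conjunct.
    + by conjunct.
  - move=> i k k' D s t t'; rewrite !gE.
    apply: prov_or_elim (prov_and_l _ _) _ _;
      apply: prov_or_elim (prov_cut (prov_and_l _ _) (prov_and_r _ _)) _ _.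
    + apply: (functional_use_single (X := compr phi) (i := i) (s := s) g1F);
        by conjunct.
    + by apply: (single12 i i k k' _ s); conjunct.
    + by apply: eqv_flip; apply: (single12 i i k' k _ s); conjunct.
    + apply: (functional_use_single (X := compr psi) (i := i) (s := s) g2F);
        by conjunct.
  - move=> i; rewrite -[X in _ |-- X]fsub_id.
    apply: prov_cut cpq _; apply: prov_or.
      apply: (functional_total_elim (X := compr phi) g1F (i := i) (s := sid _)).
        by rewrite fsub_id; apply: prov_id.
      move=> k E w u; rewrite !fsub_comp.
      apply: (@functional_total_intro T (compr chi) J g i k _ _ u).
      by apply: prov_cut (prov_or_l _ _); conjunct.
    apply: (functional_total_elim (X := compr psi) g2F (i := i) (s := sid _)).
      by rewrite fsub_id; apply: prov_id.
    move=> k E w u; rewrite !fsub_comp.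
    apply: (@functional_total_intro T (compr chi) J g i k _ _ u).
    by apply: prov_cut (prov_or_r _ _); conjunct.
(* The glued morphism is a section of [m]: its composite with [m] is contained
   in the identity relation, which suffices by [mor_le]. *)
have [mu [muF mE]] := pretopos_class_surj m.
exists (pretopos_class gF); rewrite mE; symmetry.
apply: mor_le (pretopos_comp_class muF gF) erefl _ => i k D s t.
move: k1E k2E; rewrite k1g k2g mE /= !pretopos_comp_class.
move=> /pretopos_class_eq/(_ i k)[_ /(prov_subst (spair _ _)) e1].
move=> /pretopos_class_eq/(_ i k)[_ /(prov_subst (spair _ _)) e2].
apply: matrix_comp_use (prov_id _) _ => j E w u.
rewrite -[X in _ |-- X]/(fsub w (inst (compr_eqv chi) s t)) !inst_sub.
apply: (@prov_or_elim _ _ (inst (g1 i j) (scomp s w) u)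
          (inst (g2 i j) (scomp s w) u)).
- exact: prov_cut (prov_and_r _ _) (prov_and_l _ _).
- apply: (@prov_cut _ _ _ (inst (compr_eqv phi) (scomp s w) (scomp t w))).
    apply: prov_cut (e1 _ _ _).
    by apply: (matrix_comp_intro (k := j) (u := u)); conjunct.
  rewrite !compr_eqvE.
  by apply: prov_and_mono; [exact: prov_subst | exact: prov_id].
- apply: (@prov_cut _ _ _ (inst (compr_eqv psi) (scomp s w) (scomp t w))).
    apply: prov_cut (e2 _ _ _).
    by apply: (matrix_comp_intro (k := j) (u := u)); conjunct.
  rewrite !compr_eqvE.
  by apply: prov_and_mono; [exact: prov_subst | exact: prov_id].
Qed.

End Equality.
End Comprehensions.

(** * The semantics of a coherent functor *)

Section Forcing.
Variable T : coherent_theory.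
Variables (disp : Order.disp_t) (P : porderType disp).
Local Notation PT := (classifying_pretopos T).
Local Notation E := (copresheaf_topos P).
Local Notation arrow p q := (mor (c := poset_category P) p q).
Variable M : functor PT E.
Hypothesis M_coherent : coherent_functor M.
Variable A : Defs.sort T.
Implicit Types phi psi chi : formula [:: A].

Definition individual (p : P) := fob (M (compr (Top [:: A]))) p.

(** The Kripke-Joyal semantics of [phi] at the stage [p], for the sort [A] of the
    model [M]: the element [x] lies in the subobject that [M] assigns to
    [{x : A. phi}]. *)
Definition forces (p : P) phi (x : individual p) : Prop :=
  exists z : fob (M (compr phi)) p,
    component (fmor M (incl (prov_top phi))) p z = x.

Definition individual_restr (p q : P) (pq : (p <= q)%O) (x : individual p) :
    individual q :=
  fmor (M (compr (Top [:: A]))) (pq : arrow p q) x.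

Lemma individual_restr_comp (p q r : P) (pq : (p <= q)%O) (qr : (q <= r)%O)
    (pr : (p <= r)%O) (x : individual p) :
  individual_restr qr (individual_restr pq x) = individual_restr pr x.
Proof. exact: restr_comp. Qed.

Lemma forces_restr p q (pq : (p <= q)%O) phi (x : individual p) :
  forces phi x -> forces phi (individual_restr pq x).
Proof.
move=> [z <-]; exists (fmor (M (compr phi)) (pq : arrow p q) z).
exact: nat_app.
Qed.

Lemma component_comp (F G H : E) (g : mor G H) (f : mor F G) (p : P)
    (u : fob F p) :
  component (g ∘ f) p u = component g p (component f p u).
Proof. by []. Qed.

Lemma forces_mono p phi psi (x : individual p) :
  phi |-- psi -> forces phi x -> forces psi x.
Proof.
move=> pq [z <-]; exists (component (fmor M (incl pq)) p z).
by rewrite -component_comp -fmor_comp (incl_incl _ _ (prov_top phi)).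
Qed.

Lemma forces_and p phi psi (x : individual p) :
  forces phi x -> forces psi x -> forces (And phi psi) x.
Proof.
move=> [z zx] [w wx].
have := coherent_pullback M_coherent (incl_pullback (prov_and_l phi psi)
  (prov_and_r phi psi) (prov_top phi) (prov_top psi) (prov_id _)).
move=> /(pullback_element (u := z) (v := w)); rewrite zx wx.
move=> /(_ erefl) [y [yz _]]; exists y.
rewrite -zx -yz -component_comp -fmor_comp.
by rewrite (incl_incl _ _ (prov_top (And phi psi))).
Qed.

Lemma forces_or p phi psi (x : individual p) :
  forces (Or phi psi) x -> forces phi x \/ forces psi x.
Proof.
move=> [z zx].
have := coherent_union M_coherent
   (incl_mono (pq := prov_or_l phi psi)) (incl_mono (pq := prov_or_r phi psi))
   (compr_union (prov_or_l phi psi) (prov_or_r phi psi) (prov_id _)).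
rewrite fmor_id => /(union_cover z) [] [w wz]; [left|right]; exists w.
  by rewrite -zx -wz -component_comp -fmor_comp (incl_incl _ _ (prov_top phi)).
by rewrite -zx -wz -component_comp -fmor_comp (incl_incl _ _ (prov_top psi)).
Qed.

Lemma forces_bot p (x : individual p) : ~ forces (Bot _) x.
Proof.
move=> [z _].
have := coherent_least M_coherent
  (compr_least (prov_top _) (prov_id (Bot [:: A]))).
by move=> /(least_empty (p := p)); apply.
Qed.

Lemma extent_compr_weaken (sigma : formula ([::] : ctx T)) :
  extent (compr (weaken [:: A] sigma)) |-- sigma.
Proof.
rewrite -[X in _ |-- X](weaken_nil sigma).
apply: (@extent_elim T (compr (weaken [:: A] sigma))).
  by rewrite weaken_nil; apply: prov_id.
move=> i D w u; rewrite fsub_weaken.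
by apply: prov_cut (prov_and_r _ _) _; rewrite fsub_weaken; apply: prov_id.
Qed.

Lemma forces_weaken p (sigma : formula [::]) (x : individual p) :
  fob (M (sent sigma)) p -> forces (weaken [:: A] sigma) x.
Proof.
move=> y.
have [b] := @mor_to_sent T _ _ (extent_compr_weaken sigma).
have [f _] := sent_Top_terminal (compr (Top [:: A]) : PT).
have [g _] := sent_Top_terminal (sent sigma : PT).
have pb := coherent_pullback M_coherent (sent_pullback (prov_top _) f g b
  (prov_and_r _ _)).
have [|z [zx _]] := @pullback_element _ _ _ _ _ _ _ _ _ _ p x y pb.
  apply: (@terminal_unique _ _ (M (sent (Top _))) p).
  apply: (coherent_terminal M_coherent); exact: (@sent_Top_terminal T).
by exists z.
Qed.

Lemma individual_exists p :
  Top _ |-- Ex (Top [:: A]) -> inhabited (individual p).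
Proof.
move=> TX.
have {}TX : Top _ |-- extent (compr (Top [:: A])).
  apply: prov_cut TX _; apply: prov_ex.
  have := @extent_intro T (compr (Top [:: A])) ord0 _ (sid _).
  by rewrite /weaken (nil_substE (shift A [::])).
have [f _] := sent_Top_terminal (compr (Top [:: A]) : PT).
have := coherent_image M_coherent (sent_Top_image f TX).
rewrite fmor_id => im.
have [y] := terminal_inhabited p
  (coherent_terminal M_coherent (@sent_Top_terminal T)).
by have [x _] := image_surjective y im.
Qed.

End Forcing.

(** * Types as monotone families of prime filters *)
Section Types.
Variable T : coherent_theory.
Local Notation sentence := (formula ([::] : ctx T)).
Local Notation PT := (classifying_pretopos T).
Local Notation ST := (subterminals PT).

Record prime_filter (F : sentence -> Prop) : Prop := {
  filter_up : forall sigma tau, sigma |-- tau -> F sigma -> F tau;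
  filter_top : F (Top _);
  filter_and : forall sigma tau, F sigma -> F tau -> F (And sigma tau);
  filter_bot : ~ F (Bot _);
  filter_or : forall sigma tau, F (Or sigma tau) -> F sigma \/ F tau }.

Variables (disp : Order.disp_t) (P : porderType disp).
Variable F : P -> sentence -> Prop.
Hypothesis F_prime : forall p, prime_filter (F p).
Hypothesis F_mono : forall p q sigma, (p <= q)%O -> F p sigma -> F q sigma.

Local Notation E := (copresheaf_topos P).

Definition truth_functor (sigma : sentence) :
    functor (poset_category P) set_category :=
  @Functor (poset_category P) set_category (fun p => F p sigma : Type)
    (fun p q pq => F_mono pq)
    (fun p => funext (fun _ => Prop_irrelevance _ _))
    (fun p q r _ _ => funext (fun _ => Prop_irrelevance _ _)).

Lemma truth_subterminal sigma : is_subterminal (C := E) (truth_functor sigma).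
Proof.
move=> W f g; apply: nattrans_eq => p; apply/funext => u.
exact: (@Prop_irrelevance (F p sigma)).
Qed.

Lemma truth_irrelevance sigma p (u v : truth_functor sigma p) : u = v.
Proof. exact: (@Prop_irrelevance (F p sigma)). Qed.

Definition truth_mor (W : functor (poset_category P) set_category) sigma
    (WF : forall p, fob W p -> F p sigma) :
    mor (W : E) (truth_functor sigma) :=
  @pointwise_nattrans _ _ W (truth_functor sigma) WF
    (fun p q h u => truth_irrelevance _ _).

Definition type_ob (X : ST) : E := truth_functor (extent (sval X)).

Definition type_mor (X Y : ST) (f : mor X Y) : mor (type_ob X) (type_ob Y) :=
  truth_mor (W := truth_functor _)
    (fun p => filter_up (F_prime p) (extent_mor f)).

Definition type_functor : functor ST E :=
  @Functor ST E type_ob type_mor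
    (fun X => truth_subterminal _ _) (fun X Y Z g f => truth_subterminal _ _).

Lemma type_functor_mono (X Y : ST) (f : mor X Y) :
  is_mono (fmor type_functor f).
Proof. by move=> W a b _; apply: truth_subterminal. Qed.

Definition sent_sub sigma : ST :=
  exist _ (sent sigma) (@sent_subterminal T sigma).

Lemma subterminals_mono (X Y : ST) (f : mor X Y) : is_mono f.
Proof. by move=> W a b _; apply: (svalP X). Qed.

Lemma filter_of_mor_to_sent (p : P) sigma (X : ST) :
  mor X (sent_sub sigma) -> F p (extent (sval X)) -> F p sigma.
Proof.
move=> f; apply: (filter_up (F_prime p)).
exact: prov_cut (extent_mor f) (extent_sent_l _).
Qed.

Lemma sent_mor sigma (X : ST) :
  sigma |-- extent (sval X) -> inhabited (mor (sent_sub sigma) X).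
Proof. by move=> sX; apply: mor_from_sent sX; apply: (svalP X). Qed.

Lemma filter_of_mor_from_sent (p : P) sigma (X : ST) :
  mor (sent_sub sigma) X -> F p sigma -> F p (extent (sval X)).
Proof.
move=> f; apply: (filter_up (F_prime p)).
exact: prov_cut (extent_sent_r _) (extent_mor f).
Qed.

(** The universal properties among subterminal objects are tested against
    objects of the form [sent sigma], for which they become the closure
    properties of prime filters.  In [[P, Set]] the values of [type_functor] are
    subterminal, so every equation between morphisms into them holds. *)
Lemma type_functor_coherent : coherent_functor type_functor.
Proof.
split.
- move=> t tt W.
  have [f _] := tt (sent_sub (Top _)).
  have WF p : fob W p -> F p (extent (sval t)).
    move=> _; apply: filter_of_mor_from_sent f _.
    exact: filter_top (F_prime p).
  by exists (truth_mor WF); split=> // h _; apply: truth_subterminal.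
- move=> X Y Z W f g a b [_ pb]; split; first exact: truth_subterminal.
  move=> V u v _.
  pose sigma := And (extent (sval X)) (extent (sval Y)).
  have [x] := @sent_mor sigma X (prov_and_l _ _).
  have [y] := @sent_mor sigma Y (prov_and_r _ _).
  have [|h _] := pb (sent_sub sigma) x y; first exact: (svalP Z).
  have VF p : fob V p -> F p (extent (sval W)).
    move=> w; apply: filter_of_mor_from_sent h _.
    apply: (filter_and (F_prime p)).
      exact: (component u p w).
    exact: (component v p w).
  exists (truth_mor VF); split; first by split; apply: truth_subterminal.
  by move=> *; apply: truth_subterminal.
- move=> X I Y f m [_ [h fE] im]; split; first exact: type_functor_mono.
    by exists (fmor type_functor h); apply: truth_subterminal.
  (* Among subterminal objects [f] itself is monic, hence its own image. *)
  have [|k _] := im X f (@subterminals_mono _ _ _).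
    by exists (idm X); rewrite compose_id_r.
  move=> J m' _ [j _]; exists (j ∘ fmor type_functor k).
  exact: truth_subterminal.
- move=> B Y m [_ lm]; split; first exact: type_functor_mono.
  have [y] := @sent_mor (Bot _) Y (prov_bot _).
  have [k _] := lm _ y (@subterminals_mono _ _ _).
  have no p : F p (extent (sval B)) -> False.
    by move=> /(filter_of_mor_to_sent k); apply: filter_bot (F_prime p).
  move=> J m' _.
  exists (@pointwise_nattrans _ _ (truth_functor _) J
     (fun p u => False_rect _ (no p u))
     (fun p q h u => False_rect _ (no p u))).
  exact: truth_subterminal.
- move=> X1 X2 U Y m1 m2 m _ _ [_ [h1 _] [h2 _] un].
  split; first exact: type_functor_mono.
  + by exists (fmor type_functor h1); apply: truth_subterminal.
  + by exists (fmor type_functor h2); apply: truth_subterminal.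
  move=> J m' mm [j1 _] [j2 _].
  pose sigma := Or (extent (sval X1)) (extent (sval X2)).
  have [y] := @sent_mor sigma Y (prov_or (extent_mor m1) (extent_mor m2)).
  have [x1] := @mor_to_sent T (sval X1) sigma (prov_or_l _ _).
  have [x2] := @mor_to_sent T (sval X2) sigma (prov_or_r _ _).
  have [||k _] := un _ y (@subterminals_mono _ _ _).
  + by exists x1; apply: (svalP Y).
  + by exists x2; apply: (svalP Y).
  have J1 p (u v : fob J p) : u = v.
    apply: (@mono_component_inj _ _ _ _ m' p mm).
    exact: (@Prop_irrelevance (F p (extent (sval Y)))).
  have UJ p : F p (extent (sval U)) -> fob J p.
    move=> /(filter_of_mor_to_sent k) /(filter_or (F_prime p)) U12.
    have [u1|u1] := pselect (F p (extent (sval X1))).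
      exact: (component j1 p u1).
    have u2 : F p (extent (sval X2)) by case: U12.
    exact: (component j2 p u2).
  exists (@pointwise_nattrans _ _ (truth_functor _) J UJ
            (fun p q h u => J1 _ _ _)).
  exact: truth_subterminal.
Qed.

End Types.

(** * Structures and soundness *)
Section Semantics.
Variable S : signature.

Record structure := Structure {
  carrier :> Defs.sort S -> Type;
  fun_int : forall f, (forall A, var (func_dom f) A -> carrier A) ->
    carrier (func_cod f);
  rel_int : forall R, (forall A, var (rel_dom R) A -> carrier A) -> Prop }.

Implicit Types N M : structure.

Definition env (N : structure) (G : ctx S) := forall A, var G A -> N A.

Definition env_nil N : env N [::] := fun A v =>
  match v in var G' A' return match G' with [::] => N A' | _ => unit end with
  | vz _ _ => tt
  | vs _ _ _ _ => tt
  end.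

Definition env_cons N G B (a : N B) (e : env N G) : env N (B :: G) := fun A v =>
  match v in var (B' :: G') A' return N B' -> env N G' -> N A' with
  | vz _ _ => fun a _ => a
  | vs _ _ _ v' => fun _ e => e _ v'
  end a e.

Fixpoint eval N G (e : env N G) A (t : term G A) : N A :=
  match t with
  | tvar A v => e A v
  | tapp f ts => fun_int (fun B v => eval e (ts B v))
  end.

Fixpoint sat N G (phi : formula G) : env N G -> Prop :=
  match phi in formula G return env N G -> Prop with
  | Rel _ R ts => fun e => rel_int (fun B v => eval e (ts B v))
  | Eq _ _ t u => fun e => eval e t = eval e u
  | Top _ => fun e => True
  | And _ p q => fun e => sat p e /\ sat q e
  | Bot _ => fun e => False
  | Or _ p q => fun e => sat p e \/ sat q e
  | Ex _ A p => fun e => exists a : N A, sat p (env_cons a e)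
  end.

Lemma env_eq N G (e f : env N G) : (forall A v, e A v = f A v) -> e = f.
Proof.
by move=> ef; apply: functional_extensionality_dep => A; apply/funext => v.
Qed.

Lemma env_nilE N (e : env N [::]) : e = env_nil N.
Proof.
apply: env_eq => A v.
exact: (match v as v' in var G' A' return
  match G' return var G' A' -> Prop with
  | [::] => fun w => e A' w = env_nil N w | _ => fun _ => True end v' with
  vz _ _ => I | vs _ _ _ _ => I end).
Qed.

Definition env_sub N G D (s : subst G D) (e : env N D) : env N G :=
  fun A v => eval e (s A v).

Lemma eval_sub N G D (s : subst G D) (e : env N D) A (t : term G A) :
  eval e (tsub s t) = eval (env_sub s e) t.
Proof. by elim: t => //= f ts IH; congr fun_int; apply: env_eq. Qed.

Lemma env_sub_scons N G D B (t : term D B) (s : subst G D) (e : env N D) :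
  env_sub (scons t s) e = env_cons (eval e t) (env_sub s e).
Proof. by apply: env_eq; apply: var_caseP. Qed.

Lemma env_sub_up N G D B (s : subst G D) (e : env N D) (a : N B) :
  env_sub (up B s) (env_cons a e) = env_cons a (env_sub s e).
Proof.
rewrite env_sub_scons; congr env_cons.
by apply: env_eq => A v; rewrite /env_sub /scomp eval_sub.
Qed.

Lemma sat_sub N G D (s : subst G D) (phi : formula G) (e : env N D) :
  sat (fsub s phi) e = sat phi (env_sub s e).
Proof.
elim: phi D s e => //=.
- move=> H R ts D s e; congr rel_int; apply: env_eq => A v; exact: eval_sub.
- by move=> H A t u D s e; rewrite !eval_sub.
- by move=> H p IHp q IHq D s e; rewrite IHp IHq.
- by move=> H p IHp q IHq D s e; rewrite IHp IHq.
- move=> H A p IHp D s e; congr (ex _); apply/funext => a.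
  by rewrite IHp env_sub_up.
Qed.

Record hom (N M : structure) := Hom {
  hom_map :> forall A, N A -> M A;
  hom_fun : forall f (x : forall A, var (func_dom f) A -> N A),
    hom_map (fun_int x) = fun_int (fun A v => hom_map (x A v));
  hom_rel : forall R (x : forall A, var (rel_dom R) A -> N A),
    rel_int x -> rel_int (fun A v => hom_map (x A v)) }.

Lemma eval_hom N M (h : hom N M) G (e : env N G) A (t : term G A) :
  h A (eval e t) = eval (fun B v => h B (e B v)) t.
Proof.
by elim: t => //= f ts IH; rewrite hom_fun; congr fun_int; apply: env_eq.
Qed.

Lemma sat_hom N M (h : hom N M) G (phi : formula G) (e : env N G) :
  sat phi e -> sat phi (fun A v => h A (e A v)).
Proof.
elim: phi e => //=.
- move=> H R ts e /(hom_rel h).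
  suff -> : (fun A v => h A (eval e (ts A v))) =
            (fun B v => eval (fun A v => h A (e A v)) (ts B v)) by [].
  by apply: env_eq => A v; apply: eval_hom.
- by move=> H A t u e tu; rewrite -!eval_hom tu.
- by move=> H p IHp q IHq e [/IHp ? /IHq].
- by move=> H p IHp q IHq e [/IHp|/IHq]; [left|right].
- move=> H A p IHp e [a /IHp pa]; exists (h A a).
  suff -> : env_cons (h A a) (fun B v => h B (e B v)) =
            (fun B v => h B (env_cons a e v)) by [].
  by apply: env_eq; apply: var_caseP.
Qed.

End Semantics.

Definition is_model (T : coherent_theory) (N : structure T) :=
  forall G (p q : formula G), @axioms T G p q ->
  forall e : env N G, sat p e -> sat q e.

Lemma soundness (T : coherent_theory) (N : structure T) G (p q : formula G)
    (e : env N G) :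
  is_model N -> prov p q -> sat p e -> sat q e.
Proof.
move=> Nm pq; elim: pq e => {G p q} /=; try by [].
- by move=> G p q r _ IH1 _ IH2 e /IH1 /IH2.
- by move=> G D s p q _ IH e; rewrite !sat_sub; apply: IH.
- by move=> G A t u p e [tu]; rewrite !sat_sub !env_sub_scons tu.
- by move=> G p q e [].
- by move=> G p q e [].
- by move=> G p q r _ IH1 _ IH2 e pe; split; [apply: IH1|apply: IH2].
- by move=> G p q e pe; left.
- by move=> G p q e pe; right.
- by move=> G p q r _ IH1 _ IH2 e [/IH1|/IH2].
- by move=> G A p q _ IH e [a /IH]; rewrite sat_sub.
- move=> G A p q _ IH e pe; rewrite sat_sub; apply: IH; exists (e A (vz _ _)).
  rewrite -[X in sat _ X](_ : e = _) //.
  by apply: env_eq; apply: var_caseP.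
- by move=> G p q r e [pe [qe|re]]; [left|right].
- by move=> G A p q e [pe [a qa]]; exists a; rewrite sat_sub.
Qed.

Lemma theory_prime_filter (T : coherent_theory) (N : structure T) :
  is_model N ->
  prime_filter (fun sigma : formula ([::] : ctx T) => sat sigma (env_nil N)).
Proof.
move=> Nm; split=> //= sigma tau st; exact: soundness.
Qed.

(** * The twisted diagram *)

Definition stage := option (bool * bool).
HB.instance Definition _ := Choice.on stage.

Notation origin := (None : stage).
Notation middle s := (Some (false, s) : stage).
Notation upper e := (Some (true, e) : stage).

Definition rank (p : stage) : nat :=
  match p with None => 0 | Some (false, _) => 1 | Some (true, _) => 2 end.

Definition stage_le (p q : stage) := (p == q) || (rank p < rank q).

Lemma stage_le_refl : reflexive stage_le.
Proof. by move=> p; rewrite /stage_le eqxx. Qed.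

Lemma stage_le_anti : antisymmetric stage_le.
Proof. by move=> [[[] []]|] [[[] []]|]. Qed.

Lemma stage_le_trans : transitive stage_le.
Proof. by move=> [[[] []]|] [[[] []]|] [[[] []]|]. Qed.

HB.instance Definition _ := Order.Le_isPOrder.Build (Order.Disp tt tt) stage
  stage_le_refl stage_le_anti stage_le_trans.

Inductive symbol := side of bool | sign of bool | mark of bool & bool.

Definition twist_sig : signature :=
  @Signature unit
    Empty_set (fun f => match f with end) (fun f => match f with end)
    symbol (fun R => match R with mark _ _ => [:: tt] | _ => [::] end).

Local Notation unary := ([:: tt] : ctx twist_sig).

Definition side_sentence (s : bool) : formula ([::] : ctx twist_sig) :=
  @Rel twist_sig [::] (side s) (sid [::]).
Definition sign_sentence (e : bool) : formula ([::] : ctx twist_sig) :=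
  @Rel twist_sig [::] (sign e) (sid [::]).
Definition mark_formula (s v : bool) : formula unary :=
  @Rel twist_sig unary (mark s v) (sid unary).

Inductive twist_axiom :
  forall G : ctx twist_sig, formula G -> formula G -> Prop :=
| inhabited_axiom :
    twist_axiom (Top ([::] : ctx twist_sig)) (@Ex twist_sig [::] tt (Top unary))
| side_axiom s :
    twist_axiom (weaken unary (side_sentence s))
      (Or (mark_formula s true) (mark_formula s false))
| sign_axiom e v w : (v == w) != e ->
    twist_axiom
      (And (weaken unary (sign_sentence e))
           (And (mark_formula true v) (mark_formula false w)))
      (Bot unary).

Definition twist : coherent_theory := CoherentTheory twist_axiom.

(** At [upper e] both marks of [b] are defined: the first is [b] itself and the
    second is [b] or its negation, so that they are equal exactly when [e]
    holds. *)
Definition mark_holds (p : stage) (s v b : bool) : bool :=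
  match p with
  | None => false
  | Some (false, s') => (s == s') && (v == b)
  | Some (true, e) => v == (if s then b else b == e)
  end.

Definition stage_model (p : stage) : structure twist_sig :=
  @Structure twist_sig (fun _ => bool) (fun f => match f with end)
    (fun R => match R
       return
         (forall A, var (rel_dom (s := twist_sig) R) A -> bool) -> Prop with
     | side s => fun _ => stage_le (middle s) p
     | sign e => fun _ => p = upper e
     | mark s v => fun x => mark_holds p s v (x tt (vz _ _))
     end).

Lemma stage_model_is_model p : @is_model twist (stage_model p).
Proof.
move=> G phi psi; case=> [|s|e v w vw] x /=.
- by move=> _; exists true.
- move: (x tt _) => /= b {x}.
  by case: p b => [[[] s']|] [] //=; case: s s' => [] [] //=; auto.
- move: (x tt _) => /= b {x} [-> /=].
  by case: v w e b vw => [] [] [] [] //= _ [].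
Qed.

(** Preserving the second mark forces the map from [middle false] to [upper e],
    which makes the square from [origin] to [upper false] fail to
    commute. *)
Definition twist_map (p q : stage) (b : bool) : bool :=
  match p, q with
  | Some (false, false), Some (true, e) => b == e
  | _, _ => b
  end.

Lemma twist_hom p q :
  stage_le p q -> inhabited (hom (stage_model p) (stage_model q)).
Proof.
move=> pq; constructor.
unshelve refine (@Hom twist_sig (stage_model p) (stage_model q)
                   (fun _ => twist_map p q) _ _).
  by case.
case=> [s|e|s v] x /=.
- by move=> sp; apply: stage_le_trans sp pq.
- move=> {x} pe; move: pq; rewrite pe {pe}; by case: q e => [[[] []]|] [].
- move: (x tt _) => /= c {x}; move: pq.
  case: p => [[[] a]|] //=; case: q => [[[] b]|] //=.
  + by case: a b => [] [].
  + by move=> _; case: a s b c v => [] [] [] [] [].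
  + by case: a b => [] [].
Qed.

Definition stage_theory (p : stage) (sigma : formula ([::] : ctx twist)) :
    Prop :=
  sat sigma (env_nil (stage_model p)).

Lemma stage_theory_mono (p q : stage) sigma :
  (p <= q)%O -> stage_theory p sigma -> stage_theory q sigma.
Proof.
move=> /twist_hom [h] /(sat_hom h).
by rewrite (env_nilE (fun _ _ => _)).
Qed.

Lemma stage_theory_prime (p : stage) : prime_filter (stage_theory p).
Proof. exact: theory_prime_filter (@stage_model_is_model p). Qed.

Theorem theorem1p5 :
  exists (disp : Order.disp_t) (P : porderType disp) (T : coherent_theory),
    ~ realises_types T (copresheaf_topos P).
Proof.
exists _, (stage : porderType _), twist.
move=> /(_ _ (type_functor_coherent stage_theory_prime stage_theory_mono)).
move=> [M M_coherent [eta]].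
have realised p sigma : stage_theory p sigma -> fob (M (sent sigma)) p.
  move=> ps; apply: (component (component eta (sent_sub sigma)) p).
  exact: (filter_up (stage_theory_prime p) (extent_sent_r _) ps).
have [x] := @individual_exists twist _ _ M M_coherent tt origin
  (@prov_axiom twist _ _ _ inhabited_axiom).
have om s : (origin <= middle s)%O by [].
have mu s e : (middle s <= upper e)%O by [].
have marked s : exists v,
    forces (T := twist) (A := tt) (mark_formula s v)
      (individual_restr (om s) x).
  have : forces (T := twist) (A := tt) (weaken unary (side_sentence s))
           (individual_restr (om s) x).
    apply: forces_weaken => //; apply: realised.
    by rewrite /stage_theory /= /stage_le eqxx.
  move=> /(forces_mono (@prov_axiom twist _ _ _ (side_axiom s))).
  move=> /forces_or [] // ?.
    by exists true.
  by exists false.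
have [v xv] := marked true; have [w xw] := marked false.
(* The upper stage at which these two marks are incompatible. *)
pose e := v != w.
have ou : (origin <= upper e)%O by [].
apply: (@forces_bot _ _ _ _ M_coherent _ _ (individual_restr ou x)).
apply: (forces_mono
  (@prov_axiom twist _ _ _ (sign_axiom (e := e) (v := v) (w := w) _))).
  by rewrite /e; case: (v == w).
apply: forces_and => //.
  by apply: forces_weaken => //; apply: realised.
apply: forces_and => //.
  rewrite -(individual_restr_comp (om true) (mu true e)).
  exact: forces_restr.
rewrite -(individual_restr_comp (om false) (mu false e)).
exact: forces_restr.
Qed.
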